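(* Assume (A1), (A2), (A3) (see context). Suppose there exist a locally bounded measurable function $\phi:\mathbb R_+\to\mathbb R_+$ and constants $C_0>0$, $\zeta\ge0$ such that $\phi(r)\le C_0r^{-2+\zeta}$ for $r\ge1$, and for $\mathcal P_0$-a.a. $\omega$, $$\mathrm E_0[c_{0,x}(\omega)\mid\hat\omega]\le\phi(|x|)\qquad\text{for all }x\in\hat\omega\text{ with }x\sim0 .$$ Then $\lambda_0,\lambda_2\in L^1(\mathcal P_0)$ provided at least one of the following holds: (H1) $\rho_\gamma<+\infty$ for some $\gamma>2$, and Condition $C(\alpha)$ holds for some $\alpha>\frac{\gamma}{\gamma-2}(d+\zeta)$; (H2) $\rho_2<+\infty$ and $\mathbb P$ has finite range of dependence; (H3) $\rho_2<+\infty$, $\mathbb P$ has positive association, and Condition $C(\alpha)$ holds for some $\alpha>d+\zeta$.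
   Context: Notation: $|\cdot|$ is the Euclidean norm on $\mathbb R^d$, $\Lambda_r=[-r,r]^d$. $\mathcal N$ is the set of locally finite subsets of $\mathbb R^d$; $\xi\in\mathcal N$ is identified with the counting measure $\sum_{x\in\xi}\delta_x$, so $\xi(A)=\#(\xi\cap A)$; $\mathcal N$ carries the $\sigma$-algebra generated by $\xi\mapsto\xi(A)$, $A$ Borel. Translations: $\tau_x\xi:=\xi-x$. Voronoi cell: $\mathrm{Vor}(x|\xi)=\{y:|y-x|\le|y-z|\ \forall z\in\xi\}$ for $x\in\xi$. The Delaunay triangulation $\mathrm{DT}(\xi)$ is the graph on $\xi$ whose edges are the pairs $\{x,y\}$, $x\ne y$, with $\mathrm{Vor}(x|\xi)$, $\mathrm{Vor}(y|\xi)$ sharing a $(d-1)$-dimensional face; write $x\sim y$. Setting: $(\Omega,\mathcal F,\mathcal P)$ probability space (expectation $\mathrm E$) with a measurable action $(\theta_x)_{x\in\mathbb R^d}$ of $\mathbb R^d$; $\omega\mapsto\hat\omega\in\mathcal N$ a simple point process with law $\mathbb P$ (expectation $\mathbb E$); $c_{x,y}(\omega)\ge0$ a measurable symmetric conductance field with $c_{x,x}=0$ and $c_{x,y}(\omega)=0$ unless $\{x,y\}$ is an edge of $\mathrm{DT}(\hat\omega)$. (A1) $\mathcal P$ is invariant under all $\theta_x$ and $\mathcal P(\hat\omega=\emptyset)=0$; (A2) $m:=\mathbb E[\xi([0,1]^d)]\in(0,\infty)$; (A3) there is a measurable $\theta$-invariant $\Omega_*$ of full measure such that for $\omega\in\Omega_*$: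 $\widehat{\theta_x\omega}=\tau_x\hat\omega$ for all $x$ and $c_{y-x,z-x}(\theta_x\omega)=c_{y,z}(\omega)$ for all $x$ and all edges $\{y,z\}$ of $\mathrm{DT}(\hat\omega)$. Palm distribution: $\mathcal P_0(A)=\frac1m\int d\mathcal P(\omega)\sum_{x\in\hat\omega\cap[0,1]^d}\mathbf 1_A(\theta_x\omega)$, concentrated on $\Omega_0=\{\omega:0\in\hat\omega\}$, expectation $\mathrm E_0$. For $\omega\in\Omega_0$ and $k=0,2$: $\lambda_k(\omega):=\sum_{x\in\hat\omega:x\sim0}c_{0,x}(\omega)|x|^k$. $\rho_\gamma:=\mathbb E[\xi([0,1]^d)^\gamma]$. Condition $C(\alpha)$: there is $\kappa>0$ with $\mathbb P(\xi(\Lambda_\ell)=0)\le\kappa\ell^{-\alpha}$ for all $\ell\ge1$. Finite range of dependence: there is $L>0$ such that for Borel $A,B$ at distance $\ge L$, $\xi\cap A$ and $\xi\cap B$ are independent under $\mathbb P$. Positive association: for weakly increasing $f,g$ and pairwise disjoint bounded Borel sets $A_1,\dots,A_n,B_1,\dots,B_k$, $\mathrm{Cov}_{\mathbb P}(f(\xi(A_1),\dots,\xi(A_n)),g(\xi(B_1),\dots,\xi(B_k)))\ge0$ whenever both have finite second moments. *)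

(* Defs.v *)
From HB Require Import structures.
From mathcomp Require Import all_boot all_order all_algebra.
From mathcomp Require Import all_classical all_reals all_analysis measurable_realfun.
Import Order.TTheory GRing.Theory Num.Theory.
Set Implicit Arguments. Unset Strict Implicit. Unset Printing Implicit Defensive.
Local Open Scope classical_set_scope.
Local Open Scope ring_scope.

Section Defs.
Variable R : realType.
Variable d : nat.

Notation vec := 'rV[R]_d.

Definition enorm (v : vec) : R := Num.sqrt (\sum_(i < d) v ord0 i ^+ 2).

Definition eopen (A : set vec) : Prop :=
  forall x, A x -> exists e : R, 0 < e /\ forall y, enorm (y - x) < e -> A y.
Definition borelV : set (set vec) := <<s [set A | eopen A] >>.

Definition Lam (r : R) : set vec := [set v | forall i, `|v ord0 i| <= r].
Definition cube01 : set vec := [set v | forall i, 0 <= v ord0 i <= 1].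
Definition bounded_set (A : set vec) : Prop := exists r : R, A `<=` Lam r.

Definition locfin (xi : set vec) : Prop :=
  forall A, bounded_set A -> finite_set (xi `&` A).

Definition cnt (xi : set vec) (A : set vec) : \bar R := (\esum_(x in xi `&` A) 1)%E.

Definition Vor (xi : set vec) (x : vec) : set vec :=
  [set y | forall z, xi z -> enorm (y - x) <= enorm (y - z)].

Definition aff_indep (k : nat) (p : 'I_k -> vec) : Prop :=
  forall a : 'I_k -> R, \sum_(i < k) a i = 0 -> \sum_(i < k) a i *: p i = 0 ->
    forall i, a i = 0.

(* Delaunay edge x ~ y: the Voronoi cells of x and y share a (d-1)-dimensional
   face, i.e. their (convex) intersection contains d affinely independent
   points (its affine dimension is d-1; it always lies in the bisector
   hyperplane). *)
Definition DTedge (xi : set vec) (x y : vec) : Prop :=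
  [/\ xi x, xi y, x <> y &
   exists p : 'I_d -> vec,
     (forall i, Vor xi x (p i) /\ Vor xi y (p i)) /\ aff_indep p].

Definition prod_sig (dO : measure_display) (O : measurableType dO) :
  set (set (vec * O)) :=
  <<s [set E | exists A U, [/\ borelV A, measurable U & E = A `*` U]] >>.
Definition prod2_sig (dO : measure_display) (O : measurableType dO) :
  set (set ((vec * vec) * O)) :=
  <<s [set E | exists A B U,
        [/\ borelV A, borelV B, measurable U & E = (A `*` B) `*` U]] >>.

Definition N_gen : set (set (set vec)) :=
  [set E | exists A (S : set (\bar R)),
     [/\ borelV A, measurable S & E = [set xi | S (cnt xi A)]]].
Definition N_sig_x : set (set (set vec * vec)) :=
  <<s [set E | exists D B, [/\ N_gen D, borelV B & E = D `*` B]] >>.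

Section Proc.
Variables (dO : measure_display) (O : measurableType dO).
Variable P : probability O R.
Variable pts : O -> set vec.
Variable theta : vec -> O -> O.

Definition intensity : \bar R := (\int[P]_w cnt (pts w) cube01)%E.

Definition rho (g : R) : \bar R :=
  (\int[P]_w ((fine (cnt (pts w) cube01)) `^ g)%:E)%E.

Definition E0 (f : O -> \bar R) : \bar R :=
  ((fine intensity)^-1%:E *
   \int[P]_w (\esum_(x in pts w `&` cube01) f (theta x w)))%E.

Definition condC (alpha : R) : Prop :=
  exists kappa : R, 0 < kappa /\ forall l : R, 1 <= l ->
    (P [set w | cnt (pts w) (Lam l) = 0%E] <= (kappa * l `^ (- alpha))%:E)%E.

Definition sig_restr (A : set vec) : set (set O) :=
  <<s [set U | exists E (S : set (\bar R)),
       [/\ borelV E, measurable S & U = [set w | S (cnt (pts w) (A `&` E))]]] >>.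

Definition finite_range : Prop :=
  exists L : R, 0 < L /\
    forall A B, borelV A -> borelV B ->
      (forall a b, A a -> B b -> L <= enorm (a - b)) ->
      forall U V, sig_restr A U -> sig_restr B V ->
        P (U `&` V) = (P U * P V)%E.

Definition coord_incr (n : nat) (f : ('I_n -> R) -> R) : Prop :=
  forall u v : 'I_n -> R, (forall i, u i <= v i) -> f u <= f v.

Definition pos_assoc : Prop :=
  forall (n k : nat) (f : ('I_n -> R) -> R) (g : ('I_k -> R) -> R)
         (A : 'I_n -> set vec) (B : 'I_k -> set vec),
    coord_incr f -> coord_incr g ->
    (forall i, borelV (A i) /\ bounded_set (A i)) ->
    (forall j, borelV (B j) /\ bounded_set (B j)) ->
    (forall i i', i <> i' -> A i `&` A i' = set0) ->
    (forall j j', j <> j' -> B j `&` B j' = set0) ->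
    (forall i j, A i `&` B j = set0) ->
    let X := fun w => f (fun i => fine (cnt (pts w) (A i))) in
    let Y := fun w => g (fun j => fine (cnt (pts w) (B j))) in
    (\int[P]_w ((X w) ^+ 2)%:E < +oo)%E ->
    (\int[P]_w ((Y w) ^+ 2)%:E < +oo)%E ->
    0 <= \int[P]_w (X w * Y w) - (\int[P]_w X w) * (\int[P]_w Y w).

End Proc.
End Defs.

Definition lamk (R : realType) (d : nat) (dO : measure_display)
  (O : measurableType dO) (pts : O -> set 'rV[R]_d)
  (c : 'rV[R]_d -> 'rV[R]_d -> O -> R) (k : nat) (w : O) : \bar R :=
  (\esum_(x in [set x | DTedge (pts w) 0 x]) (c 0 x w * enorm x ^+ k)%:E)%E.

(* Main.v *)
(** Every sign vector [s] singles out an orthant.  If the points seen from a point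
    of the process meet, in each orthant, a box at distance of order [l], then all
    Delaunay neighbours lie within distance [72 d l].  Hence an edge longer than
    that forces an empty box, so [lambda_k] is dominated by the number of points in
    a dyadic annulus, weighted by [phi] and restricted to the event of such a hole.
    Under the Palm measure this becomes a sum of second moments of the number of
    points in unit cubes on the event that a large box is empty.  Each of (H1),
    (H2), (H3) bounds such a moment by [C l^(-beta)] with [beta > d + zeta]: (H1) by
    truncation, (H2) and (H3) by decoupling a cube from a distant box.  A unit cube
    is far from one of two well separated test boxes in the same orthant, so this
    always applies, and the dyadic sum converges. *)

Require Import Defs.
From HB Require Import structures.
From mathcomp Require Import all_boot all_order all_algebra finmap.
From mathcomp Require Import all_classical all_reals all_analysis measurable_realfun.
From mathcomp Require Import ring lra.
Import Order.TTheory GRing.Theory Num.Theory numFieldNormedType.Exports.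
Local Open Scope classical_set_scope.
Local Open Scope ring_scope.

Set Implicit Arguments.
Unset Strict Implicit.
Unset Printing Implicit Defensive.

(** * Orthant boxes and Delaunay neighbours *)

(** The weight |x|^k with k <= 2 is absorbed by the factor r^(-2) in the bound on [phi]. An annulus
    of radius of order l thus contributes l^zeta from [phi], l^d unit cubes in which to count, and
    l^(-beta) from the hole, which is where beta > d + zeta comes from. Second moments appear
    because the Palm sum already counts one point in the unit cube and the annulus counts another.
    The empty box is seen from a random point of the unit cube; it contains slightly smaller boxes
    placed around the origin, and these give finitely many fixed events. The obstacle is that
    measurability of the Delaunay relation is not established. Conductances vanish off the edges, so
    [lamk] is summed over all points; the conditional expectation is tested only on explicit sets of
    configurations; and integrals are compared by lemmas that ask no measurability of the smaller
    function. *)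

Definition euc (R : realType) (d : nat) : measurableType _ :=
  g_sigma_algebraType [set A : set 'rV[R]_d | eopen A].

(** Gives access to products, sections and measurable functions on [euc R d]. *)
Lemma borelVE (R : realType) (d : nat) : @borelV R d = @measurable _ (euc R d).
Proof. by []. Qed.

Arguments cube01 {R d}.

Section geometry.
Context {R : realType} {d : nat}.
Implicit Types (x y z u v : 'rV[R]_d) (xi A B : set 'rV[R]_d).

Definition box u (r : R) : set 'rV[R]_d :=
  [set v | forall i, `|v ord0 i - u ord0 i| <= r].

Lemma enorm_ge0 v : 0 <= enorm v.
Proof. exact: sqrtr_ge0. Qed.

Lemma sumsq_ge0 v : 0 <= \sum_(i < d) v ord0 i ^+ 2.
Proof. by apply: sumr_ge0 => i _; rewrite sqr_ge0. Qed.

Lemma sqr_enorm v : enorm v ^+ 2 = \sum_(i < d) v ord0 i ^+ 2.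
Proof. by rewrite sqr_sqrtr// sumsq_ge0. Qed.

Lemma coord_le_enorm v i : `|v ord0 i| <= enorm v.
Proof.
rewrite -sqrtr_sqr ler_sqrt ?sumsq_ge0// (bigD1 i)//= lerDl.
by apply: sumr_ge0 => j _; rewrite sqr_ge0.
Qed.

Lemma ler_enorm u v :
  (enorm u <= enorm v) = (\sum_(i < d) u ord0 i ^+ 2 <= \sum_(i < d) v ord0 i ^+ 2).
Proof. by rewrite ler_sqrt// sumsq_ge0. Qed.

Lemma enorm_le v (r : R) : 0 <= r ->
  (enorm v <= r) = (\sum_(i < d) v ord0 i ^+ 2 <= r ^+ 2).
Proof. by move=> r0; rewrite -sqr_enorm ler_pXn2r// ?nnegrE// enorm_ge0. Qed.

Lemma borelV_open A : eopen A -> borelV A.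
Proof. by move=> oA; exact: sub_gen_smallest. Qed.

Lemma borelVC A : borelV A -> borelV (~` A).
Proof. by rewrite borelVE; exact: measurableC. Qed.

Lemma borelV_setT : borelV (setT : set 'rV[R]_d).
Proof. by rewrite borelVE; exact: measurableT. Qed.

Lemma borelV_box u r : borelV (box u r).
Proof.
suff h : eopen (~` box u r) by rewrite -(setCK (box u r)); exact (borelVC (borelV_open h)).
move=> x /=; move=> /existsNP[i] /negP; rewrite -ltNge => xi.
exists (`|x ord0 i - u ord0 i| - r); split; first by rewrite subr_gt0.
move=> y yx /(_ i) yu.
have := le_lt_trans (coord_le_enorm (y - x) i) yx; rewrite !mxE => yxi.
have := ler_distD (y ord0 i) (x ord0 i) (u ord0 i).
rewrite (distrC (x ord0 i) (y ord0 i)); lra.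
Qed.

Lemma bounded_box u r : Defs.bounded_set (box u r).
Proof.
exists (enorm u + r) => v vu i; have := vu i; have := coord_le_enorm u i.
have := ler_distD (u ord0 i) (v ord0 i) 0; rewrite !subr0; lra.
Qed.

Lemma cube01E : @cube01 R d = box (const_mx 2^-1) 2^-1 :> set 'rV[R]_d.
Proof.
apply/seteqP; split => v /= h i; have := h i; rewrite mxE ler_norml; lra.
Qed.

Lemma LamE r : @Lam R d r = box 0 r.
Proof. by apply/seteqP; split => v /= h i; have := h i; rewrite mxE subr0. Qed.

Lemma borelV_coord i (a : R) : borelV [set v : 'rV[R]_d | v ord0 i <= a].
Proof.
suff h : eopen (~` [set v : 'rV[R]_d | v ord0 i <= a]).
  by rewrite -(setCK [set _ | _]); exact (borelVC (borelV_open h)).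
move=> x /= /negP.
rewrite -ltNge => xi; exists (x ord0 i - a); split; first by rewrite subr_gt0.
move=> y yx /= yi.
have := le_lt_trans (coord_le_enorm (y - x) i) yx; rewrite !mxE ltr_norml; lra.
Qed.

Definition sgnv (s : {ffun 'I_d -> bool}) : 'rV[R]_d := \row_i (-1) ^+ s i.

Lemma sgnv_cases s i : sgnv s ord0 i = 1 \/ sgnv s ord0 i = -1.
Proof. by rewrite mxE; case: (s i); [right|left]; rewrite ?expr1 ?expr0. Qed.

Definition orthant_box (a b : R) s := box (((a + b) / 2) *: sgnv s) ((b - a) / 2).

Lemma orthant_boxP a b s z : orthant_box a b s z <->
  forall i, a <= sgnv s ord0 i * z ord0 i <= b.
Proof.
have e i : (((a + b) / 2) *: sgnv s) ord0 i = (a + b) / 2 * sgnv s ord0 i.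
  by rewrite [LHS]mxE.
split=> h i; have := h i; rewrite e ler_norml;
  by case: (sgnv_cases s i) => ->; lra.
Qed.

(* A common point [p] of the cells of [0] and [y] satisfies
   [2 <p, z> <= |z|^2] for every [z] in [xi]; testing this against a point in the
   orthant of [p] bounds the l1-norm of [p], and [|y| <= 2 |p|]. *)
Lemma Delaunay_edge_bound xi y (l : R) : (0 < d)%N -> 0 < l ->
  DTedge xi 0 y ->
  (forall s, exists2 z, xi z & orthant_box (l / 2) (6 * l) s z) ->
  enorm y <= 72 * d%:R * l.
Proof.
move=> d0 l0 [xi0 _ _ [ps [psV _]]] hit.
have [{ps psV}p [Vp0 Vpy]] : exists p, Vor xi 0 p /\ Vor xi y p.
  by exists (ps (Ordinal d0)); exact: psV.
pose s := [ffun i => p ord0 i < 0]; have [z xiz /orthant_boxP sz] := hit s.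
have sp i : sgnv s ord0 i * p ord0 i = `|p ord0 i|.
  by rewrite mxE ffunE; case: ltrP => h;
    rewrite ?expr1 ?expr0 ?mul1r ?mulN1r ?(ger0_norm h) ?(ltr0_norm h).
have ss i : sgnv s ord0 i * sgnv s ord0 i = 1.
  by case: (sgnv_cases s i) => ->; rewrite ?mulr1 ?mulrNN ?mulr1.
set S1 := \sum_i `|p ord0 i|.
have S10 : 0 <= S1 by exact: sumr_ge0.
have S1l : l * S1 <= 36 * d%:R * l ^+ 2.
  have := Vp0 z xiz; rewrite ler_enorm => h.
  (* With t = s_i z_i in [l/2, 6l], the difference is 2 |p_i| t - t^2, at least l |p_i| - 36 l^2. *)
  have h1 i : (p - 0) ord0 i ^+ 2 - (p - z) ord0 i ^+ 2 >=
      l * `|p ord0 i| - 36 * l ^+ 2.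
    rewrite !mxE oppr0 addr0.
    have -> : p ord0 i ^+ 2 - (p ord0 i - z ord0 i) ^+ 2 =
        2 * (sgnv s ord0 i * p ord0 i) * (sgnv s ord0 i * z ord0 i)
        - (sgnv s ord0 i * z ord0 i) ^+ 2.
      transitivity (2 * (sgnv s ord0 i * sgnv s ord0 i) * p ord0 i * z ord0 i
        - (sgnv s ord0 i * sgnv s ord0 i) * z ord0 i ^+ 2); last by ring.
      by rewrite ss; ring.
    rewrite sp; have := sz i; move: (sgnv _ _ _ * _) => t /andP[t1 t2].
    have := normr_ge0 (p ord0 i); nra.
  have : \sum_i (l * `|p ord0 i| - 36 * l ^+ 2) <= 0.
    apply: (@le_trans _ _ (\sum_i ((p - 0) ord0 i ^+ 2 - (p - z) ord0 i ^+ 2))).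
      by apply: ler_sum.
    by rewrite sumrB subr_le0.
  rewrite sumrB -mulr_sumr sumr_const card_ord -mulr_natr -/S1; lra.
have {}S1l : S1 <= 36 * d%:R * l.
  by move: S1l; rewrite (_ : 36 * d%:R * l ^+ 2 = l * (36 * d%:R * l)) ?ler_pM2l//; ring.
have pS1 : \sum_i p ord0 i ^+ 2 <= S1 ^+ 2.
  rewrite expr2 /S1 mulr_suml; apply: ler_sum => i _.
  rewrite -[X in X <= _]ger0_norm ?sqr_ge0// normrX expr2 ler_wpM2l//.
  by rewrite (bigD1 i)//= lerDl sumr_ge0.
rewrite enorm_le ?mulr_ge0// ?ler0n// ?(ltW l0)//.
(* This is (2 p_i - y_i)^2 >= 0. Summed with |p - y| <= |p| it gives |y| <= 2 |p| <= 2 S1, whence 72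
   = 2 . 36. *)
have h i : y ord0 i ^+ 2 <= 2 * (p - y) ord0 i ^+ 2 + 2 * p ord0 i ^+ 2.
  by rewrite !mxE; have := sqr_ge0 (2 * p ord0 i - y ord0 i); nra.
have hy : \sum_i (p - y) ord0 i ^+ 2 <= \sum_i p ord0 i ^+ 2.
  by have := Vpy 0 xi0; rewrite subr0 ler_enorm.
apply: (@le_trans _ _ (4 * S1 ^+ 2)).
  apply: (le_trans (ler_sum _ (fun i _ => h i))).
  by rewrite big_split/= -!mulr_sumr; lra.
have : S1 ^+ 2 <= (36 * d%:R * l) ^+ 2.
  by rewrite ler_pXn2r// ?nnegrE// (le_trans S10).
nra.
Qed.

End geometry.

(** * Counting points *)

Section esum_facts.
Context {R : realType} {T : choiceType}.
Implicit Types (S : set T) (a : T -> \bar R).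
Local Open Scope ereal_scope.

Lemma esum_subset S1 S2 a : S1 `<=` S2 ->
  \esum_(x in S1) a x <= \esum_(x in S2) a x.
Proof.
move=> S12; apply: le_ereal_sup => _ [A [fA AS1] <-].
by exists A => //; split => //; exact: subset_trans S12.
Qed.

Lemma le_esum_term S a x : S x -> (forall y, S y -> 0 <= a y) ->
  a x <= \esum_(y in S) a y.
Proof.
move=> Sx a0; rewrite -(@esum_set1 _ _ x a) ?a0//.
by apply: esum_subset => _ ->.
Qed.

(** One inequality for all nonnegative scalars suffices: applied to the inverse of k and the family
    k a, it gives the other one. *)
Lemma esumZl (k : R) S a : (0 <= k)%R -> (forall x, 0 <= a x) ->
  \esum_(x in S) (k%:E * a x) = k%:E * \esum_(x in S) a x.
Proof.
have le (r : R) (b : T -> \bar R) : (0 <= r)%R -> (forall x, 0 <= b x) ->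
    \esum_(x in S) (r%:E * b x) <= r%:E * \esum_(x in S) b x.
  move=> r0 b0; apply: ge_ereal_sup => _ [A fA <-]; rewrite -ge0_mule_fsumr//.
  by rewrite lee_wpmul2l ?lee_fin// ereal_sup_ubound//; exists A.
move=> k0 a0; apply/eqP; rewrite eq_le le//=.
have [->|kn0] := eqVneq k 0%R.
  by rewrite mul0e esum_ge0// => x _; rewrite mul0e.
have {}k0 : (0 < k)%R by rewrite lt_neqAle eq_sym kn0.
have kV : (0 <= k^-1)%R by rewrite invr_ge0 ltW.
have ka x : 0 <= k%:E * a x by rewrite mule_ge0// lee_fin ltW.
have := le _ _ kV ka; under eq_esum do rewrite muleA -EFinM mulVf ?gt_eqF// mul1e.
move=> /(lee_wpmul2l (_ : 0 <= k%:E)); rewrite muleA -EFinM divff ?gt_eqF// mul1e.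
by apply; rewrite lee_fin ltW.
Qed.

(** Tonelli for sums: both sides are sums over a product, exchanged by swapping coordinates. *)
Lemma esum_nneseries S (a : nat -> T -> \bar R) :
  (forall n x, 0 <= a n x) ->
  \esum_(x in S) \sum_(n <oo) a n x = \sum_(n <oo) \esum_(x in S) a n x.
Proof.
move=> a0; rewrite nneseries_esumT; last by move=> n; exact: esum_ge0.
under eq_esum do rewrite nneseries_esumT//.
rewrite (@esum_esum _ _ _ S (fun=> setT))// (@esum_esum _ _ _ setT (fun=> S))//.
rewrite (reindex_esum (setT `*`` (fun=> S)) _ (fun x => (x.2, x.1)))//.
split => [[i j] []|[i j] [k l] _ _ [-> ->]|[i j] [Si _]]//=.
by exists (j, i).
Qed.

Lemma esum_indic S (A : set T) :
  \esum_(x in S) (\1_A x : R)%:E = \esum_(x in S `&` A) 1.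
Proof.
rewrite esum_mkcondr; apply: eq_esum => x _.
by rewrite indicE; case: ifP.
Qed.

Lemma finite_esum1 S : finite_set S -> \esum_(x in S) (1 : \bar R) = (#|` fset_set S|)%:R%:E.
Proof.
move=> fS; rewrite esum_fset// fsbig_finite// card_fset_sum1 natr_sum -sumEFin.
by [].
Qed.

End esum_facts.

Section counting.
Context {R : realType} {d : nat}.
Implicit Types (x y z u v : 'rV[R]_d) (xi A B : set 'rV[R]_d).
Local Open Scope ereal_scope.

Lemma cnt_ge0 xi A : 0 <= cnt xi A.
Proof. exact: esum_ge0. Qed.

Lemma cntE xi A : locfin xi -> Defs.bounded_set A ->
  cnt xi A = (#|` fset_set (xi `&` A)|)%:R%:E.
Proof. by move=> lf bA; rewrite /cnt finite_esum1//; exact: lf. Qed.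

Lemma cnt_fin xi A : locfin xi -> Defs.bounded_set A -> cnt xi A \is a fin_num.
Proof. by move=> lf bA; rewrite cntE. Qed.

Lemma cnt_fineK xi A : locfin xi -> Defs.bounded_set A ->
  (fine (cnt xi A))%:E = cnt xi A.
Proof. by move=> lf bA; rewrite fineK// cnt_fin. Qed.

Lemma le_cnt xi A B : A `<=` B -> cnt xi A <= cnt xi B.
Proof. by move=> AB; apply: esum_subset => x [xix /AB]. Qed.

Lemma cnt_eq0P xi A : cnt xi A = 0 <-> xi `&` A = set0.
Proof.
split => [h|h]; last by rewrite /cnt h esum_set0.
rewrite -subset0 => x xA.
have : 1 <= cnt xi A by exact: (@le_esum_term _ _ (xi `&` A) (fun=> 1) x).
by rewrite h lee_fin ler10.
Qed.

Lemma cnt_neq0 xi A : cnt xi A <> 0 -> exists2 z, xi z & A z.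
Proof.
move=> h; apply: contrapT => n; apply/h/cnt_eq0P; rewrite -subset0 => x [xix Ax].
by apply: n; exists x.
Qed.

Lemma cnt_cover (K : finType) xi A (B : K -> set 'rV[R]_d) :
  A `<=` [set x | exists k, B k x] -> cnt xi A <= \sum_k cnt xi (B k).
Proof.
move=> AB; pose f x : \bar R := \sum_k (\1_(B k) x : R)%:E.
apply: (@le_trans _ _ (\esum_(x in xi `&` A) f x)).
  apply: le_esum => x [_ /AB[k Bkx]]; rewrite /f (bigD1 k)//= indicE mem_set//.
  by rewrite leeDl// sume_ge0// => j _; rewrite lee_fin.
rewrite esum_sum => [|x k _ _]; last by rewrite lee_fin.
apply: lee_sum => k _; rewrite esum_indic; apply: esum_subset => x [[]//].
Qed.

Lemma esum_translate xi x (a : 'rV[R]_d -> \bar R) :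
  \esum_(y in [set z - x | z in xi]%R) a y = \esum_(z in xi) a (z - x)%R.
Proof. by rewrite esum_image// => y z _ _ /addIr. Qed.

Lemma cnt_translate xi x A :
  cnt [set z - x | z in xi]%R A = cnt xi [set z | A (z - x)%R].
Proof.
rewrite /cnt -!esum_indic esum_translate; apply: eq_esum => z _.
by rewrite !indicE; congr ((_ : bool)%:R%:E); apply/idP/idP; rewrite !inE.
Qed.

Lemma preimage_box_translate u (r : R) x :
  [set z | box u r (z - x)%R] = box (u + x)%R r.
Proof.
by apply/seteqP; split => z /= h i; have := h i; rewrite !mxE;
  congr (`|_| <= _)%R; ring.
Qed.

End counting.

Section lattice_cover.
Context {R : realType} {d : nat}.
Implicit Types (N : nat).

Definition grid_pt N (k : {ffun 'I_d -> 'I_(2 * N)}) : 'rV[R]_d :=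
  \row_i ((k i)%:R - N%:R + 2^-1).

Lemma Lam_grid N : (0 < N)%N ->
  Lam N%:R `<=` [set x | exists k, box (@grid_pt N k) 2^-1 x].
Proof.
move=> N0 v vN.
have h i : exists j : 'I_(2 * N), (j%:R <= v ord0 i + N%:R <= j%:R + 1).
  have := vN i; rewrite ler_norml => /andP[v1 v2].
  have t0 : 0 <= v ord0 i + N%:R by lra.
  have /andP[tn1] := truncn_itv t0; rewrite -natr1 => tn2.
  case: (ltnP (Num.truncn (v ord0 i + N%:R)) (2 * N)) => [lt|ge].
    by exists (Ordinal lt) => /=; rewrite tn1 ltW.
  (* Only v_i = N, the right end of the cube, gets here; it is put in the last cell. *)
  have lt : ((2 * N).-1 < 2 * N)%N by rewrite prednK// muln_gt0.
  have e : (2 * N).-1%:R = 2 * N%:R - 1 :> R.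
    by rewrite -natrM -[in RHS](prednK (_ : 0 < 2 * N)%N) ?muln_gt0// -natr1 addrK.
  exists (Ordinal lt) => /=; rewrite e.
  have := ge; rewrite -(ler_nat R) natrM => ge'; lra.
have [k hk] := choice h; exists [ffun i => k i] => i.
by rewrite !mxE ffunE ler_norml; have := hk i; lra.
Qed.

End lattice_cover.

(** * Measurability of sums over the points of the process *)

Section measurable_sum.
Context {R : realType} {d : nat} {dO : measure_display} {O : measurableType dO}.
Variable pts : O -> set 'rV[R]_d.
Hypothesis lf : forall w, locfin (pts w).
Hypothesis mcnt : forall A, borelV A -> measurable_fun setT (fun w => cnt (pts w) A).
Local Open Scope ereal_scope.
Local Notation V := (euc R d).
Import HBNNSimple.

Section window.
Variable B : set 'rV[R]_d.
Hypotheses (mB : borelV B) (bB : Defs.bounded_set B).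

Let fB w (A : set 'rV[R]_d) : finite_set (pts w `&` B `&` A).
Proof. by apply: finite_setIl; exact: lf. Qed.

Let phi (E : set (V * O)) w := \esum_(x in pts w `&` B `&` [set x | E (x, w)]) (1 : \bar R).

Let phi_fin E w : phi E w \is a fin_num.
Proof. by rewrite /phi finite_esum1. Qed.

(** Dynkin induction. On a rectangle the sum is a count times an indicator; the window is bounded,
    so all values are finite and complements can be treated by subtraction. *)
Lemma measurable_window_indic (E : set (V * O)) : measurable E ->
  measurable_fun setT (fun w => \esum_(x in pts w `&` B) (\1_E (x, w) : R)%:E).
Proof.
move=> mE; rewrite (_ : (fun w => _) = phi E); last first.
  by apply/funext => w; rewrite /phi -esum_indic.
move: mE; rewrite measurable_prod_measurableType.
set G := [set A1 `*` A2 | A1 in _ & A2 in _] => mE.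
have GT : G setT by exists setT => //; exists setT => //; rewrite setXTT.
have phiX A1 A2 : phi (A1 `*` A2) = fun w => cnt (pts w) (B `&` A1) * (\1_A2 w : R)%:E.
  apply/funext => w; rewrite indicE; case: (boolP (w \in A2)) => [|/negP] wA.
    rewrite mule1 /phi /cnt -setIA; congr (esum (_ `&` (_ `&` _)) _).
    by apply/seteqP; split => [x []|x ?]//; split => //; exact: set_mem.
  rewrite mule0 /phi esum1// => x [_ [_ Aw]]; exfalso; apply: wA; exact: mem_set.
have GP : G `<=` [set E | measurable_fun setT (phi E)].
  move=> _ [A1 mA1 [A2 mA2 <-]] /=; rewrite phiX; apply: emeasurable_funM.
    by apply: mcnt; rewrite borelVE; apply: measurableI.
  by apply/measurable_EFinP; exact: measurable_indic.
apply: (@dynkin_induction _ (V * O)%type G (fun E => measurable_fun setT (phi E))) => //.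
- exact: measurable_prod_measurableType.
- move=> _ _ [A1 mA1 [A2 mA2 <-]] [C1 mC1 [C2 mC2 <-]].
  exists (A1 `&` C1); first exact: measurableI.
  by exists (A2 `&` C2); [exact: measurableI|rewrite setXI].
- exact: GP.
- move=> S mS mphiS; rewrite (_ : phi _ = (fun w => phi setT w - phi S w)).
    by apply: emeasurable_funB => //; exact: GP.
  apply/funext => w; have -> : phi setT w = phi (~` S) w + phi S w.
    rewrite /phi (_ : _ `&` [set x | setT _] = pts w `&` B); last first.
      by apply/seteqP; split => [x []|x ?].
    by rewrite (@esumID _ _ [set x | S (x, w)])// addeC.
  by rewrite addeK.
- move=> F mF tF mphiF; rewrite (_ : phi _ = (fun w => \sum_(k <oo) phi (F k) w)).
    by apply: ge0_emeasurable_sum => // k w _ _; exact: esum_ge0.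
  apply/funext => w; rewrite /phi.
  rewrite -nneseries_sum_bigcup//.
    congr (esum _ _); apply/seteqP; split => [x [? [k _ Fk]]|x [k _ [? Fk]]].
      by exists k.
    by split => //; exists k.
  by move=> i j _ _ [x [[_ Fi] [_ Fj]]]; apply: (tF i j) => //; exists (x, w).
Qed.

Lemma measurable_window_sum (F : V * O -> \bar R) :
  (forall z, 0 <= F z) -> measurable_fun setT F ->
  measurable_fun setT (fun w => \esum_(x in pts w `&` B) F (x, w)).
Proof.
move=> F0 mF.
have fin w : finite_set (pts w `&` B) by exact: lf.
pose g := nnsfun_approx measurableT mF.
apply: (@emeasurable_fun_cvg _ _ _ _ (fun n w => \esum_(x in pts w `&` B) (g n (x, w))%:E)).
  (* The maximum makes the coefficient nonnegative for every y, as [esumZl] and [esum_sum] require;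
     on the range of [g n] it changes nothing. *)
  move=> n; rewrite (_ : (fun w => _) = (fun w => \sum_(y <- fset_set (range (g n)))
      (Num.max y 0)%:E * \esum_(x in pts w `&` B) (\1_(g n @^-1` [set y]) (x, w) : R)%:E)).
    apply: emeasurable_sum => y; apply: measurable_funeM.
    by apply: measurable_window_indic; exact: measurable_funPTI.
  apply/funext => w; have m0 (y : R) : (0 <= Num.max y 0)%R by rewrite le_max lexx orbT.
  under eq_bigr do rewrite -esumZl//.
  rewrite -esum_sum; last by move=> x y _ _; rewrite mule_ge0// lee_fin.
  apply: eq_esum => x _; rewrite (fimfunE (g n)) fsbig_finite//= -sumEFin.
  rewrite big_seq [RHS]big_seq; apply: eq_bigr => y.
  rewrite in_fset_set//; move=> /set_mem[z _ <-].
  by rewrite max_l// -EFinM.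
move=> w _; rewrite (_ : (fun n => _) = (fun n => \sum_(x <- fset_set (pts w `&` B)) (g n (x, w))%:E)).
  rewrite esum_fset// fsbig_finite//; apply: cvg_nnesum.
    by move=> x _; apply: nearW => n; rewrite lee_fin.
  by move=> x _; apply: cvg_nnsfun_approx.
by apply/funext => n; rewrite esum_fset ?fsbig_finite// => x _; rewrite lee_fin.
Qed.

End window.

(** Space is cut into countably many disjoint bounded windows, the successive differences of the
    cubes [L n]. *)
Lemma measurable_pts_sum (F : V * O -> \bar R) :
  (forall z, 0 <= F z) -> measurable_fun setT F ->
  measurable_fun setT (fun w => \esum_(x in pts w) F (x, w)).
Proof.
move=> F0 mF; pose L n : set 'rV[R]_d := Lam n%:R.
have LT : \bigcup_n L n = setT.
  apply/seteqP; split => // x _; exists (Num.truncn (enorm x)).+1 => // i.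
  by rewrite (le_trans (coord_le_enorm _ _))// ltW// (andP (truncn_itv (enorm_ge0 _))).2.
have mL n : borelV (seqDU L n).
  rewrite borelVE; apply: (@seqDU_measurable _ (euc R d)) => k.
  by rewrite -borelVE /L LamE; exact: borelV_box.
have bL n : Defs.bounded_set (seqDU L n) by exists n%:R => x [].
rewrite (_ : (fun w => _) = (fun w => \sum_(n <oo) \esum_(x in pts w `&` seqDU L n) F (x, w))).
  apply: ge0_emeasurable_sum => [n w _ _|n _]; first exact: esum_ge0.
  exact: measurable_window_sum.
apply/funext => w; rewrite -[in LHS](setIT (pts w)) -LT seqDU_bigcup_eq setI_bigcupr.
rewrite nneseries_sum_bigcup//.
by apply: trivIset_setIl; exact: trivIset_seqDU.
Qed.

End measurable_sum.

(** * Integration without measurability *)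

Section measure_facts.
Context {dT : measure_display} {T : measurableType dT} {R : realType}.
Local Open Scope ereal_scope.

Lemma measurable_preimage_gen rT (f : T -> rT) (G : set (set rT)) :
  (forall B, G B -> measurable (f @^-1` B)) ->
  forall B, <<s G >> B -> measurable (f @^-1` B).
Proof.
move=> mG B sB.
suff /(_ B sB) : <<s G >> `<=` image_set_system setT f measurable.
  by rewrite /image_set_system /= setTI.
apply: smallest_sub; first exact/sigma_algebra_image/sigma_algebra_measurable.
by move=> C GC; rewrite /image_set_system /= setTI; exact: mG.
Qed.

(* Unlike [ge0_le_integral], neither function need be measurable: the integral of
   a nonnegative function is a supremum over the simple functions below it. *)
Lemma ge0_le_integral_gen (mu : {measure set T -> \bar R}) (f g : T -> \bar R) :
  (forall x, 0 <= f x) -> (forall x, f x <= g x) ->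
  \int[mu]_x f x <= \int[mu]_x g x.
Proof.
move=> f0 fg; have g0 x : 0 <= g x by exact: le_trans (fg x).
rewrite !ge0_integralTE//; apply: le_ereal_sup => _ [h /= hf <-].
by exists h => //= x; exact: le_trans (fg x).
Qed.

(** The exceptional set is absorbed by g: adding +oo on N keeps its integral and makes the
    domination hold everywhere, so f may be non-measurable. *)
Lemma ae_le_integral_gen (mu : {measure set T -> \bar R}) (N : set T)
    (f g : T -> \bar R) :
  measurable N -> mu N = 0 -> (forall x, 0 <= f x) -> (forall x, 0 <= g x) ->
  measurable_fun setT g -> (forall x, ~ N x -> f x <= g x) ->
  \int[mu]_x f x <= \int[mu]_x g x.
Proof.
move=> mN N0 f0 g0 mg fg; pose g' x := g x + +oo * (\1_N x : R)%:E.
have g'0 x : 0 <= g' x by rewrite /g' adde_ge0// mule_ge0// ?leey// lee_fin.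
have -> : \int[mu]_x g x = \int[mu]_x g' x.
  apply: ge0_ae_eq_integral => //.
    apply: emeasurable_funD => //; apply: measurable_funeM.
    by apply/measurable_EFinP; exact: measurable_indic.
  exists N; split => // x /= h; apply: contrapT => Nx; apply: h => _.
  by rewrite /g' indicE memNset// mule0 adde0.
apply: ge0_le_integral_gen => // x; rewrite /g' indicE.
have [_|/negP h] := boolP (x \in N); last first.
  by rewrite mule0 adde0 fg// => Nx; apply: h; exact: mem_set.
by rewrite mule1 addey ?leey// gt_eqF// (lt_le_trans _ (g0 x)).
Qed.

Lemma measure_eq_ae (P : probability T R) (W A B : set T) :
  measurable W -> P W = 1 -> measurable A -> measurable B ->
  A `&` W = B `&` W -> P A = P B.
Proof.
move=> mW PW.
have WC : P (~` W) = 0 by rewrite probability_setC// PW subee.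
have le C D : measurable C -> measurable D -> C `&` W `<=` D -> P C <= P D.
  move=> mC mD CD; have mU := measurableU _ _ mD (measurableC mW).
  apply: (@le_trans _ _ (P (D `|` ~` W))).
    rewrite le_measure ?inE//.
    by move=> x Cx; have [Wx|Wx] := pselect (W x); [left; exact: CD|right].
  apply: (le_trans (measureU2 P mD (measurableC mW))).
  by rewrite [X in _ + X](_ : _ = 0) ?adde0.
move=> mA mB AB; apply/eqP; rewrite eq_le !le// ?AB// -?AB; exact: subIsetl.
Qed.

(** Both integrals are taken over a common image measure. Two measures are allowed because
    independence will compare [P] restricted to an event with a multiple of [P]. *)
Lemma eq_dist_integral d' (T' : measurableType d')
    (m1 m2 : {measure set T -> \bar R}) (f1 f2 : T -> T')  (g : T' -> \bar R)
  (mf1 : measurable_fun setT f1) (mf2 : measurable_fun setT f2) :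
  measurable_fun setT g -> (forall y, 0 <= g y) ->
  (forall S, measurable S -> m1 (f1 @^-1` S) = m2 (f2 @^-1` S)) ->
  \int[m1]_x g (f1 x) = \int[m2]_x g (f2 x).
Proof.
pose pushM (m : {measure set T -> \bar R}) (f : T -> T') mf :=
  @measure_function_pushforward__canonical__measure_function_Measure _ _ _ _ R m f mf.
move=> mg g0 m12.
transitivity (\int[pushM m1 f1 mf1]_y g y).
  by apply/esym/(ge0_integral_pushforward mf1 m1 measurableT mg) => y _.
transitivity (\int[pushM m2 f2 mf2]_y g y).
  by apply: (eq_measure_integral (pushM m2 f2 mf2)) => S mS _; exact: m12.
by apply: (ge0_integral_pushforward mf2 m2 measurableT mg) => y _.
Qed.

End measure_facts.

(** * From generated sigma-algebras to measurability on product types *)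

Section product_sigma_algebras.
Context {R : realType} {d : nat} {dO : measure_display} {O : measurableType dO}.
Local Notation V := (euc R d).

Lemma prod_sig_measurable (E : set (V * O)) : prod_sig (O:=O) E -> measurable E.
Proof.
apply: (@measurable_preimage_gen _ (V * O)%type _ id) => _ [A [U [mA mU ->]]].
exact: (@measurableX _ _ V O A U).
Qed.

Lemma prod2_sig_section (x : 'rV[R]_d) E : prod2_sig (O:=O) E ->
  measurable [set p : V * O | E ((x, p.1), p.2)].
Proof.
apply: (@measurable_preimage_gen _ (V * O)%type _ (fun p => ((x, p.1), p.2))).
move=> _ [A [B [U [mA mB mU ->]]]].
have [Ax|nAx] := pselect (A x).
  rewrite (_ : _ @^-1` _ = B `*` U); first exact: (@measurableX _ _ V O B U).
  by apply/seteqP; split => -[y w] //= [] // [].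
rewrite (_ : _ @^-1` _ = set0); first exact: measurable0.
by apply/seteqP; split => -[y w] //= [] [].
Qed.

Lemma N_sig_x_preimage (pts : O -> set 'rV[R]_d) :
  (forall A, borelV A -> measurable_fun setT (fun w => cnt (pts w) A)) ->
  forall D, N_sig_x D -> measurable [set p : V * O | D (pts p.2, p.1)].
Proof.
move=> mcnt; apply: (@measurable_preimage_gen _ (V * O)%type _ (fun p => (pts p.2, p.1))).
move=> _ [D [B [[A [S [mA mS ->]]] mB ->]]].
rewrite (_ : _ @^-1` _ = B `*` [set w | S (cnt (pts w) A)]).
  apply: (@measurableX _ _ V O B) => //.
  by rewrite -[X in measurable X]setTI; exact: (mcnt _ mA).
by apply/seteqP; split => -[y w] //= [].
Qed.

End product_sigma_algebras.

(** * Palm sums and stationarity *)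

Section Palm_calculus.
Context {R : realType} {d : nat} {dO : measure_display} {O : measurableType dO}.
Variables (P : probability O R) (theta : 'rV[R]_d -> O -> O) (pts : O -> set 'rV[R]_d).
Hypothesis mtheta : forall U, measurable U -> prod_sig (O:=O) [set p | U (theta p.1 p.2)].
Hypothesis lf : forall w, locfin (pts w).
Hypothesis mcnt : forall A, borelV A -> measurable_fun setT (fun w => cnt (pts w) A).
Local Open Scope ereal_scope.
Local Notation V := (euc R d).

(** [E0] without the factor 1/m, which is only a positive finite constant. *)
Definition palm_sum (f : O -> \bar R) : \bar R :=
  \int[P]_w \esum_(x in pts w `&` @cube01 R d) f (theta x w).

Lemma measurable_theta : measurable_fun setT (fun p : V * O => theta p.1 p.2).
Proof. by move=> _ U mU; rewrite setTI; apply: prod_sig_measurable; exact: mtheta. Qed.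

Lemma borel_cube01 : borelV (@cube01 R d).
Proof. by rewrite cube01E; exact: borelV_box. Qed.

Lemma bounded_cube01 : Defs.bounded_set (@cube01 R d).
Proof. by rewrite cube01E; exact: bounded_box. Qed.

Lemma measurable_palm_sum (f : O -> \bar R) :
  (forall w, 0 <= f w) -> measurable_fun setT f ->
  measurable_fun setT (fun w => \esum_(x in pts w `&` @cube01 R d) f (theta x w)).
Proof.
move=> f0 mf.
apply: (measurable_window_sum lf mcnt borel_cube01 bounded_cube01
  (F := fun p : V * O => f (theta p.1 p.2))) => //.
exact: measurableT_comp mf measurable_theta.
Qed.

Lemma le_palm (f g : O -> \bar R) : (forall w, 0 <= f w) ->
  (forall w, f w <= g w) -> palm_sum f <= palm_sum g.
Proof.
move=> f0 fg; apply: ge0_le_integral_gen => w; first exact: esum_ge0.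
exact: le_esum.
Qed.

Lemma palmZl (k : R) (f : O -> \bar R) : (0 <= k)%R ->
  (forall w, 0 <= f w) -> measurable_fun setT f ->
  palm_sum (fun w => k%:E * f w) = k%:E * palm_sum f.
Proof.
move=> k0 f0 mf; rewrite /palm_sum; under eq_integral do rewrite esumZl//.
rewrite ge0_integralZl_EFin//; first by move=> w _; exact: esum_ge0.
exact: measurable_palm_sum.
Qed.

Lemma palm_nneseries (f : nat -> O -> \bar R) :
  (forall n w, 0 <= f n w) -> (forall n, measurable_fun setT (f n)) ->
  palm_sum (fun w => \sum_(n <oo) f n w) = \sum_(n <oo) palm_sum (f n).
Proof.
move=> f0 mf; rewrite /palm_sum; under eq_integral do rewrite esum_nneseries//.
rewrite integral_nneseries// => [n|n w _]; last exact: esum_ge0.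
exact: measurable_palm_sum.
Qed.

(** A nonnegative measurable sum with zero integral vanishes almost surely, and so does each of its
    terms. This carries a Palm-null set over to a [P]-null one. *)
Lemma palm_null (N : set O) : measurable N -> palm_sum (fun w => (\1_N w : R)%:E) = 0 ->
  exists M : set O, [/\ measurable M, P M = 0 &
    forall w, ~ M w -> forall x, pts w x -> @cube01 R d x -> ~ N (theta x w)].
Proof.
move=> mN.
have m1 : measurable_fun setT (fun w => (\1_N w : R)%:E).
  by apply/measurable_EFinP; exact: measurable_indic.
set F := fun w => \esum_(x in pts w `&` @cube01 R d) (\1_N (theta x w) : R)%:E.
have F0 w : 0 <= F w by apply: esum_ge0 => x _; rewrite lee_fin.
have mF : measurable_fun setT F.
  by apply: (measurable_palm_sum (f := fun w => (\1_N w : R)%:E)) => // w; rewrite lee_fin.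
move=> h; have : \int[P]_w `|F w| = 0.
  by under eq_integral do rewrite gee0_abs//.
move=> /(ae_eq_integral_abs _ measurableT mF)[M [mM PM hM]].
exists M; split => // w Mw x ptx cx Nx; apply: Mw; apply: hM => /= /(_ I) F0w.
have : (\1_N (theta x w) : R)%:E <= F w.
  apply: (le_esum_term (a := fun x => (\1_N (theta x w) : R)%:E)) .
    by split.
  by move=> y _; rewrite lee_fin.
by rewrite F0w indicE mem_set//= lee_fin ler10.
Qed.

Section stationarity.
Variable Os : set O.
Hypothesis Pinv : forall x U, measurable U -> P (theta x @^-1` U) = P U.
Hypothesis mOs : measurable Os.
Hypothesis POs : P Os = 1.
Hypothesis Os_theta : forall w, Os w -> forall x, pts (theta x w) = [set y - x | y in pts w]%R.

Lemma measurable_cnt_set A (S : set (\bar R)) : borelV A -> measurable S ->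
  measurable [set w | S (cnt (pts w) A)].
Proof. by move=> mA mS; rewrite -[X in measurable X]setTI; exact: mcnt. Qed.

Lemma measurable_theta_preimage x U : measurable U -> measurable (theta x @^-1` U).
Proof.
move=> mU; have := measurable_theta measurableT mU; rewrite setTI => mE.
have := measurable_xsection (x : V) mE; rewrite /xsection /=.
by congr measurable; apply/seteqP; split => w /=; rewrite inE.
Qed.

(** Invariance of [P] moves the box, but the translation rule for [pts] is known on [Os] only, so
    the two events are compared there. *)
Lemma prob_cnt_box u r x (S : set (\bar R)) : measurable S ->
  P [set w | S (cnt (pts w) (box (u + x) r))] = P [set w | S (cnt (pts w) (box u r))].
Proof.
move=> mS; rewrite -[RHS](Pinv x); last exact: measurable_cnt_set (borelV_box _ _) mS.
apply: (measure_eq_ae mOs POs).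
- exact: measurable_cnt_set (borelV_box _ _) mS.
- by apply: measurable_theta_preimage; exact: measurable_cnt_set (borelV_box _ _) mS.
apply/seteqP; split => w /= [h Ow]; split => //; move: h;
  by rewrite Os_theta// cnt_translate preimage_box_translate.
Qed.

Lemma prob_cnt_box_center u v r (S : set (\bar R)) : measurable S ->
  P [set w | S (cnt (pts w) (box u r))] = P [set w | S (cnt (pts w) (box v r))].
Proof. by move=> mS; rewrite -(prob_cnt_box v r (u - v) mS) addrC subrK. Qed.

End stationarity.
End Palm_calculus.

(** * Second moments on the event of an empty box *)

Section restriction.
Context {dT : measure_display} {T : measurableType dT} {R : realType}.
Local Open Scope ereal_scope.

(** Turns the weight 1_U into a change of measure, so that independence can be used as an equality
    of laws. The measure is split over U and its complement, where the integrand vanishes. *)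
Lemma le_integral_mrestr (mu : {measure set T -> \bar R}) (U : set T)
    (mU : measurable U) (f : T -> \bar R) :
  (forall x, 0 <= f x) -> measurable_fun setT f ->
  \int[mu]_x (f x * (\1_U x : R)%:E) <= \int[mrestr mu mU]_x f x.
Proof.
move=> f0 mf; have mUC := measurableC mU.
have m1 : measurable_fun setT (fun x => f x * (\1_U x : R)%:E).
  by apply: emeasurable_funM => //; apply/measurable_EFinP; exact: measurable_indic.
have f10 x : 0 <= f x * (\1_U x : R)%:E by rewrite mule_ge0// lee_fin.
have -> : \int[mu]_x (f x * (\1_U x : R)%:E) =
    \int[measure_add (mrestr mu mU) (mrestr mu mUC)]_x (f x * (\1_U x : R)%:E).
  apply: eq_measure_integral => A mA _; transitivity (mu (A `&` U) + mu (A `&` ~` U)); last first.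
    exact/esym/measure_addE.
  rewrite -[in LHS](setIT A) -(setUv U) setIUr measureU//; try exact: measurableI.
  by rewrite setIACA setICr setI0.
rewrite ge0_integral_measure_add//.
rewrite [X in _ + X](_ : _ = 0) ?adde0.
  apply: ge0_le_integral_gen => // x; rewrite indicE; case: (x \in U).
    by rewrite mule1.
  by rewrite mule0.
transitivity (\int[mrestr mu mUC]_x (cst 0 x : \bar R)); last exact: integral0.
apply: ge0_ae_eq_integral => //.
exists U; split => //; first by transitivity (mu (U `&` ~` U)); [|rewrite setICr measure0].
move=> x /= h; apply: contrapT => Ux; apply: h => _.
by rewrite indicE memNset// mule0.
Qed.

End restriction.

Section empty_box_moments.
Context {R : realType} {d : nat} {dO : measure_display} {O : measurableType dO}.
Variables (P : probability O R) (pts : O -> set 'rV[R]_d).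
Hypothesis lf : forall w, locfin (pts w).
Hypothesis mcnt : forall A, borelV A -> measurable_fun setT (fun w => cnt (pts w) A).
Hypothesis stat : forall u v r (S : set (\bar R)), measurable S ->
  P [set w | S (cnt (pts w) (box u r))] = P [set w | S (cnt (pts w) (box v r))].
Local Open Scope ereal_scope.

Definition num_pts w (A : set 'rV[R]_d) : R := fine (cnt (pts w) A).
Definition no_pts (A : set 'rV[R]_d) : set O := [set w | cnt (pts w) A = 0].

Lemma npts_ge0 w A : (0 <= num_pts w A)%R.
Proof. by rewrite fine_ge0// cnt_ge0. Qed.

Lemma measurable_npts A : borelV A -> measurable_fun setT (num_pts ^~ A).
Proof. by move=> mA; apply: measurableT_comp => //; exact: mcnt. Qed.

Lemma measurable_no_pts A : borelV A -> measurable (no_pts A).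
Proof.
move=> mA; rewrite /no_pts -[X in measurable X]setTI.
exact: (mcnt mA measurableT (emeasurable_set1 0)).
Qed.

Lemma subset_no_pts A B : A `<=` B -> no_pts B `<=` no_pts A.
Proof.
by move=> AB w h; apply/eqP; rewrite eq_le cnt_ge0 andbT -h le_cnt.
Qed.

Lemma prob_no_pts_box v r : P (no_pts (box v r)) = P (no_pts (Lam r)).
Proof. by rewrite LamE; exact: (stat v 0%R r (emeasurable_set1 0)). Qed.

Lemma integral_npts_box u (g : R -> R) : measurable_fun setT g ->
  (forall y, 0 <= g y)%R ->
  \int[P]_w (g (num_pts w (box u 2^-1)))%:E = \int[P]_w (g (num_pts w cube01))%:E.
Proof.
move=> mg g0; rewrite cube01E.
apply: (eq_dist_integral (f1 := fun w => cnt (pts w) (box u 2^-1)%R)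
  (f2 := fun w => cnt (pts w) (box (const_mx 2^-1) 2^-1)%R)
  (g := fun y => (g (fine y))%:E)).
- exact (mcnt (borelV_box _ _)).
- exact (mcnt (borelV_box _ _)).
- by apply/measurable_EFinP; apply: measurableT_comp.
- by move=> y; rewrite lee_fin.
- by move=> S mS; exact: stat.
Qed.

Lemma rho2E : rho P pts 2 = \int[P]_w (num_pts w cube01 ^+ 2)%:E.
Proof. by apply: eq_integral => w _; rewrite -powR_mulrn ?npts_ge0. Qed.

(* [decoupled beta]: emptiness of a box of side [l] at distance at least of order
   [l] from a unit cube costs [l^(-beta)], even weighted by the second moment of
   the number of points in the cube. *)
Definition decoupled (beta : R) : Prop := exists C l0 : R,
  [/\ (0 <= C)%R, (1 <= l0)%R & forall (l : R) (u v : 'rV[R]_d), (l0 <= l)%R ->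
    (exists i, l <= `|u ord0 i - v ord0 i|)%R ->
    \int[P]_w (num_pts w (box u 2^-1) ^+ 2 * \1_(no_pts (box v (l / 2))) w)%:E
      <= (C * l `^ (- beta))%:E].

Lemma condC_no_pts (alpha : R) : condC P pts alpha -> exists kappa : R, (0 < kappa)%R /\
  forall (l : R) v, (2 <= l)%R ->
    P (no_pts (box v (l / 2))) <= (kappa * l `^ (- alpha))%:E.
Proof.
(* The factor 2^alpha pays for the passage from l to l / 2. *)
move=> [kappa [k0 hk]]; exists (kappa * 2 `^ alpha)%R; split.
  by rewrite mulr_gt0// powR_gt0.
move=> l v l2; rewrite prob_no_pts_box (le_trans (hk _ _))//; first lra.
rewrite lee_fin -mulrA ler_pM2l//.
rewrite powRM ?invr_ge0//; last lra.
by rewrite -[2^-1%R]powR_inv1// -powRrM mulN1r opprK mulrC.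
Qed.

Lemma moment_decoupled (gamma alpha : R) : (2 < gamma)%R -> (0 < alpha)%R ->
  rho P pts gamma < +oo -> condC P pts alpha ->
  decoupled (alpha * ((gamma - 2) / gamma)).
Proof.
move=> g2 a0 rfin /condC_no_pts[kappa [k0 hk]].
set r := rho P pts gamma.
have r0 : 0 <= r by apply: integral_ge0 => w _; rewrite lee_fin powR_ge0.
have rE : r = (fine r)%:E by rewrite fineK// ge0_fin_numE.
exists (kappa + fine r)%R, 2%R; split; [|lra|].
  by rewrite addr_ge0 ?fine_ge0 ?(ltW k0).
move=> l u v l2 _; have l0 : (0 < l)%R by lra.
(* This truncation level balances the two error terms: t^2 l^(-alpha) and t^(2 - gamma) both equal
   l^(-alpha (gamma - 2) / gamma). *)
pose t := (l `^ (alpha / gamma))%R; have t0 : (0 < t)%R by rewrite powR_gt0.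
have ptw w : (num_pts w (box u 2^-1) ^+ 2 * \1_(no_pts (box v (l / 2))) w <=
    t ^+ 2 * \1_(no_pts (box v (l / 2))) w
    + t `^ (2 - gamma) * num_pts w (box u 2^-1) `^ gamma)%R.
  move: (npts_ge0 w (box u 2^-1)); set q := num_pts _ _ => q0.
  have [qt|tq] := leP q t.
    apply: (@le_trans _ _ (t ^+ 2 * \1_(no_pts (box v (l / 2))) w)%R).
      by rewrite ler_wpM2r// ler_pXn2r// nnegrE// ltW.
    by rewrite lerDl mulr_ge0// powR_ge0.
  (* The exponent 2 - gamma is negative, so q > t gives q^(2 - gamma) <= t^(2 - gamma). *)
  have q1 : (q ^+ 2 <= t `^ (2 - gamma) * q `^ gamma)%R.
    have qp : (0 < q)%R by exact: lt_trans tq.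
    rewrite -powR_mulrn// -[X in (q `^ X <= _)%R](subrK gamma).
    rewrite powRD; last by rewrite (gt_eqF qp) implybT.
    rewrite ler_wpM2r ?powR_ge0//.
    rewrite -opprB !powRN lef_pV2 ?posrE ?powR_gt0//.
    by rewrite ge0_ler_powR ?nnegrE// ?ltW//; lra.
  rewrite (@le_trans _ _ (q ^+ 2))%R//.
    by rewrite ler_piMr ?sqr_ge0// indicE; case: (_ \in _).
  by rewrite (le_trans q1)// lerDr mulr_ge0 ?sqr_ge0.
have mV := measurable_no_pts (borelV_box v (l / 2)).
have mg : measurable_fun setT (fun y : R => y `^ gamma)%R by exact: measurable_powR.
apply: (@le_trans _ _ (\int[P]_w ((t ^+ 2)%:E * (\1_(no_pts (box v (l / 2))) w)%:E
    + (t `^ (2 - gamma))%:E * (num_pts w (box u 2^-1) `^ gamma)%:E))).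
  apply: ge0_le_integral_gen => w; first by rewrite lee_fin mulr_ge0 ?sqr_ge0.
  by rewrite -!EFinM -EFinD lee_fin.
have m1 : measurable_fun setT (fun w => (\1_(no_pts (box v (l / 2))) w : R)%:E).
  by apply/measurable_EFinP; exact: measurable_indic.
have m2 : measurable_fun setT (fun w => (num_pts w (box u 2^-1) `^ gamma)%:E).
  apply/measurable_EFinP.
  exact (measurableT_comp mg (measurable_npts (borelV_box u 2^-1))).
rewrite ge0_integralD//; first last.
- exact: measurable_funeM.
- by move=> w _; rewrite mule_ge0// lee_fin powR_ge0.
- exact: measurable_funeM.
- by move=> w _; rewrite mule_ge0// lee_fin ?sqr_ge0.
rewrite !ge0_integralZl_EFin ?sqr_ge0 ?powR_ge0//; try by move=> w _; rewrite lee_fin ?powR_ge0.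
rewrite integral_indic// setIT (integral_npts_box u mg); last first.
  by move=> y; exact: powR_ge0.
rewrite [X in _ + _ * X](_ : _ = r) // rE mulrDl EFinD leeD//.
  apply: (@le_trans _ _ ((t ^+ 2)%:E * (kappa * l `^ (- alpha))%:E)).
    by rewrite lee_wpmul2l ?lee_fin ?sqr_ge0// hk.
  rewrite -EFinM lee_fin mulrCA ler_pM2l// -powR_mulrn ?(ltW t0)// -powRrM.
  rewrite -powRD; last by rewrite (gt_eqF l0) implybT.
  by rewrite le_eqVlt; apply/orP; left; apply/eqP; congr (_ `^ _)%R; field; lra.
rewrite -EFinM lee_fin mulrC ler_wpM2l ?fine_ge0// -powRrM.
by rewrite le_eqVlt; apply/orP; left; apply/eqP; congr (_ `^ _)%R; field; lra.
Qed.

End empty_box_moments.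

(** * Decoupling by positive association and by finite range *)

Section assoc_and_range.
Context {R : realType} {d : nat} {dO : measure_display} {O : measurableType dO}.
Variables (P : probability O R) (pts : O -> set 'rV[R]_d).
Hypothesis lf : forall w, locfin (pts w).
Hypothesis mcnt : forall A, borelV A -> measurable_fun setT (fun w => cnt (pts w) A).
Hypothesis stat : forall u v r (S : set (\bar R)), measurable S ->
  P [set w | S (cnt (pts w) (box u r))] = P [set w | S (cnt (pts w) (box v r))].
Local Open Scope ereal_scope.
Local Notation npts := (num_pts pts).
Local Notation no_pts := (no_pts pts).

Lemma indic_no_ptsE u r w :
  \1_(no_pts (box u r)) w = (npts w (box u r) <= 0)%R%:R :> R.
Proof.
rewrite indicE; congr ((nat_of_bool _)%:R); apply/idP/idP => [/set_mem|h].
  by rewrite /no_pts /num_pts /= => ->.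
apply/mem_set; rewrite /no_pts/= -cnt_fineK//; last exact: bounded_box.
by congr (_%:E); apply/eqP; rewrite eq_le h npts_ge0.
Qed.

Lemma probability_indic U : measurable U -> \int[P]_w (\1_U w : R)%:E = P U.
Proof. by move=> mU; rewrite integral_indic// setIT. Qed.

Lemma bounded_integral_lty (f : O -> R) (M : R) :
  (forall w, 0 <= f w <= M)%R -> \int[P]_w (f w)%:E < +oo.
Proof.
move=> fM; apply: (@le_lt_trans _ _ (\int[P]_w (cst M%:E w))).
  by apply: ge0_le_integral_gen => w /=; rewrite lee_fin; case/andP: (fM w).
by rewrite integral_cst// [X in _ * X](_ : _ = 1); [rewrite mule1 ltry|exact: probability_setT].
Qed.

(** Positive association asks for finite second moments, and the squared count would need a fourth
    moment; truncation at M makes it bounded. Emptiness decreases with the points, so it enters as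
    minus its indicator, and the covariance inequality is reversed. *)
Lemma assoc_truncated u v r (M : nat) : pos_assoc P pts ->
  box u 2^-1 `&` box v r = set0 ->
  \int[P]_w (Num.min (npts w (box u 2^-1)) M%:R ^+ 2 * \1_(no_pts (box v r)) w)%:E
    <= \int[P]_w (Num.min (npts w (box u 2^-1)) M%:R ^+ 2)%:E * P (no_pts (box v r)).
Proof.
move=> pa QB0.
(* The inner maximum makes f increasing on negative arguments too, where a square would decrease;
   counts are unaffected. *)
pose f (a : 'I_1 -> R) := (Num.min (Num.max (a ord0) 0) M%:R ^+ 2)%R.
pose g (b : 'I_1 -> R) := (- (b ord0 <= 0)%R%:R)%R : R.
set X := fun w => (Num.min (npts w (box u 2^-1)) M%:R ^+ 2)%R.
have X0 w : (0 <= X w)%R by exact: sqr_ge0.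
set Y := fun w => (- \1_(no_pts (box v r)) w)%R : R.
have XM w : (X w <= M%:R ^+ 2)%R.
  by rewrite /X ler_pXn2r ?nnegrE// ?ge_min ?lexx ?orbT// le_min npts_ge0/=.
have mX : measurable_fun setT X.
  apply: measurable_funX; apply: measurable_minr => //.
  exact (measurable_npts mcnt (borelV_box u 2^-1)).
have mV := measurable_no_pts mcnt (borelV_box v r).
have key (X' Y' : O -> R) :
    (forall w, X' w = f (fun=> fine (cnt (pts w) (box u 2^-1)))) ->
    (forall w, Y' w = g (fun=> fine (cnt (pts w) (box v r)))) ->
    \int[P]_w ((X' w) ^+ 2)%:E < +oo -> \int[P]_w ((Y' w) ^+ 2)%:E < +oo ->
    (0 <= Rintegral P setT (fun w => X' w * Y' w)%R -
     Rintegral P setT X' * Rintegral P setT Y')%R.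
  move=> /funext-> /funext->; apply: (pa 1%N 1%N f g (fun=> box u 2^-1) (fun=> box v r)).
  - move=> a b ab; have h (z : R) : (0 <= Num.min (Num.max z 0) M%:R)%R.
      by rewrite le_min le_max lexx orbT ler0n.
    rewrite /f ler_pXn2r ?nnegrE//.
    by rewrite le_min !ge_min ge_max !le_max ab !lexx !orbT.
  - move=> a b ab; rewrite /g lerN2.
    have [b0|//] := leP (b ord0) 0%R; by rewrite (le_trans (ab _) b0).
  - by move=> _; split; [exact: borelV_box|exact: bounded_box].
  - by move=> _; split; [exact: borelV_box|exact: bounded_box].
  - by move=> i j; rewrite !ord1.
  - by move=> i j; rewrite !ord1.
  - by [].
have iX : \int[P]_w (X w)%:E < +oo by apply: (@bounded_integral_lty _ (M%:R ^+ 2)%R) => w; rewrite X0 XM.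
have iX2 : \int[P]_w (X w ^+ 2)%:E < +oo.
  apply: (@bounded_integral_lty _ ((M%:R ^+ 2) ^+ 2)%R) => w.
  by rewrite sqr_ge0/= ler_pXn2r// nnegrE// sqr_ge0.
have Y01 w : (0 <= (\1_(no_pts (box v r)) w : R) <= 1)%R.
  by rewrite indicE; case: (_ \in _); rewrite ?lexx ?ler01.
have iY2 : \int[P]_w (Y w ^+ 2)%:E < +oo.
  apply: (@bounded_integral_lty _ 1%R) => w.
  by rewrite sqr_ge0/= /Y sqrrN expr_le1//; case/andP: (Y01 w).
have Z0 w : (0 <= X w * \1_(no_pts (box v r)) w)%R.
  by rewrite mulr_ge0//; case/andP: (Y01 w).
have iZ : \int[P]_w (X w * \1_(no_pts (box v r)) w)%:E < +oo.
  apply: (@bounded_integral_lty _ (M%:R ^+ 2)%R) => w; rewrite Z0/=.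
  by rewrite (le_trans _ (XM w))// ler_piMr//; case/andP: (Y01 w).
(* The covariance is stated with real integrals. The sign of Y is pulled out first, then finiteness
   of all three quantities lifts the inequality to extended reals. *)
have := key X Y _ _ iX2 iY2; rewrite /Rintegral.
have -> : \int[P]_w (X w * Y w)%:E = - \int[P]_w (X w * \1_(no_pts (box v r)) w)%:E.
  rewrite -integral_ge0N; last by move=> w _; rewrite lee_fin.
  by apply: eq_integral => w _; rewrite -EFinN /Y mulrN.
have -> : \int[P]_w (Y w)%:E = - P (no_pts (box v r)).
  rewrite -probability_indic// -integral_ge0N; last first.
    by move=> w _; rewrite lee_fin; case/andP: (Y01 w).
  by apply: eq_integral => w _; rewrite -EFinN.
rewrite !fineN mulrN opprK addrC subr_ge0 => h.
have finZ : \int[P]_w (X w * \1_(no_pts (box v r)) w)%:E \is a fin_num.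
  by rewrite ge0_fin_numE// integral_ge0// => w _; rewrite lee_fin.
have finX : \int[P]_w (X w)%:E \is a fin_num.
  by rewrite ge0_fin_numE// integral_ge0// => w _; rewrite lee_fin.
rewrite -(fineK finZ) -(fineK finX).
rewrite -[P _]fineK; last exact: fin_num_measure.
rewrite -EFinM lee_fin; apply: h => w; first by rewrite /X /f max_l// npts_ge0.
by rewrite /Y /g indic_no_ptsE.
Qed.

Lemma box_disjoint (u v : 'rV[R]_d) (r s : R) i : (r + s < `|u ord0 i - v ord0 i|)%R ->
  box u r `&` box v s = set0.
Proof.
move=> h; rewrite -subset0 => z [/(_ i) zu /(_ i) zv].
have := ler_distD (z ord0 i) (u ord0 i) (v ord0 i).
by rewrite (distrC (u ord0 i) (z ord0 i)); lra.
Qed.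

Lemma assoc_decoupled (alpha : R) : rho P pts 2 < +oo -> pos_assoc P pts ->
  condC P pts alpha -> decoupled P pts alpha.
Proof.
move=> r2 pa /(condC_no_pts stat)[kappa [k0 hk]].
have r0 : 0 <= rho P pts 2 by apply: integral_ge0 => w _; rewrite lee_fin powR_ge0.
have rE : rho P pts 2 = (fine (rho P pts 2))%:E by rewrite fineK// ge0_fin_numE.
have m2 : measurable_fun setT (fun y : R => y ^+ 2)%R by exact: exprn_measurable.
exists (fine (rho P pts 2) * kappa)%R, 2%R; split; [|lra|].
  by rewrite mulr_ge0 ?fine_ge0 ?(ltW k0).
move=> l u v l2 [i hi].
(* The radii add up to 1/2 + l/2, less than l because 2 <= l. *)
have QB0 : box u 2^-1 `&` box v (l / 2) = set0 by apply: (@box_disjoint _ _ _ _ i); lra.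
set V := no_pts (box v (l / 2)).
have mV : measurable V := measurable_no_pts mcnt (borelV_box v (l / 2)).
have mN : measurable_fun setT (npts ^~ (box u 2^-1)).
  exact (measurable_npts mcnt (borelV_box u 2^-1)).
pose q w := npts w (box u 2^-1).
have q0 w : (0 <= q w)%R by exact: npts_ge0.
have trunc (M : nat) : \int[P]_w (Num.min (q w) M%:R ^+ 2 * \1_V w)%:E <=
    (fine (rho P pts 2) * kappa * l `^ (- alpha))%:E.
  apply: (le_trans (assoc_truncated M pa QB0)).
  rewrite -mulrA EFinM -rE; apply: lee_pmul.
  - by apply: integral_ge0 => w _; rewrite lee_fin sqr_ge0.
  - exact: measure_ge0.
  - rewrite (rho2E P) -(integral_npts_box mcnt stat u m2); last by move=> y; exact: sqr_ge0.
    apply: ge0_le_integral_gen => w; rewrite lee_fin ?sqr_ge0//.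
    by rewrite ler_pXn2r ?nnegrE ?le_min ?q0 ?npts_ge0//= ge_min lexx.
  - exact: hk.
have nd w M N : (M <= N)%N -> (Num.min (q w) M%:R ^+ 2 * \1_V w)%:E <=
    (Num.min (q w) N%:R ^+ 2 * \1_V w)%:E.
  move=> MN; rewrite lee_fin ler_wpM2r//.
  rewrite ler_pXn2r ?nnegrE ?le_min ?q0 ?ler0n//=.
  by rewrite !ge_min lexx/= ler_nat MN orbT.
(* Monotone convergence removes the truncation: for fixed w the truncated counts are eventually
   constant in M. *)
rewrite (_ : (fun w => _) = (fun w => limn (fun M : nat => (Num.min (q w) M%:R ^+ 2 * \1_V w)%:E))); last first.
  apply/funext => w; apply/esym/cvg_lim => //; apply: cvg_near_cst.
  near=> M; congr (_ ^+ 2 * _)%:E; rewrite min_l//; near: M.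
  exact: nbhs_infty_ger.
rewrite monotone_convergence//.
- apply: lime_le; last by apply: nearW => M; exact: trunc.
  apply: ereal_nondecreasing_is_cvgn => M N MN; apply: ge0_le_integral_gen => w.
    by rewrite lee_fin mulr_ge0 ?sqr_ge0.
  exact: nd.
- move=> M; apply/measurable_EFinP; apply: measurable_funM; last exact: measurable_indic.
  by apply: measurable_funX; apply: measurable_minr.
- by move=> M w _; rewrite lee_fin mulr_ge0 ?sqr_ge0.
- by move=> w _ M N; exact: nd.
Unshelve. all: by end_near. Qed.

Section finite_range.
Variable L : R.
Hypothesis d0 : (0 < d)%N.
Hypothesis indep : forall A B, borelV A -> borelV B ->
  (forall a b, A a -> B b -> (L <= enorm (a - b))%R) ->
  forall U V, sig_restr pts A U -> sig_restr pts B V -> P (U `&` V) = P U * P V.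

Lemma sig_restr_cnt A (S : set (\bar R)) : measurable S ->
  sig_restr pts A [set w | S (cnt (pts w) A)].
Proof.
move=> mS; apply: sub_gen_smallest; exists setT, S; split => //.
  exact: borelV_setT.
by rewrite setIT.
Qed.

Lemma sig_restr_no_pts A : sig_restr pts A (no_pts A).
Proof. exact (sig_restr_cnt (emeasurable_set1 0)). Qed.

Lemma box_separated (u v : 'rV[R]_d) (r s : R) i :
  (L + r + s <= `|u ord0 i - v ord0 i|)%R ->
  forall a b, box u r a -> box v s b -> (L <= enorm (a - b))%R.
Proof.
move=> h a b /(_ i) au /(_ i) bv; apply: (le_trans _ (coord_le_enorm _ i)).
rewrite !mxE; have := ler_distD (a ord0 i) (u ord0 i) (v ord0 i).
have := ler_distD (b ord0 i) (a ord0 i) (v ord0 i).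
by rewrite (distrC (u ord0 i) (a ord0 i)); lra.
Qed.

(** Under [P] restricted to the empty-box event, the count has its law under [P] multiplied by the
    probability of the event. *)
Lemma indep_second_moment (u v : 'rV[R]_d) (r : R) i :
  (L + 2^-1 + r <= `|u ord0 i - v ord0 i|)%R ->
  \int[P]_w (npts w (box u 2^-1) ^+ 2 * \1_(no_pts (box v r)) w)%:E
    <= P (no_pts (box v r)) * rho P pts 2.
Proof.
move=> sep; set V := no_pts _; set N := fun w => cnt (pts w) (box u 2^-1)%R.
have mV : measurable V := measurable_no_pts mcnt (borelV_box v r).
have mN : measurable_fun setT N := mcnt (borelV_box u 2^-1).
have m2 : measurable_fun setT (fun y : R => y ^+ 2)%R by exact: exprn_measurable.
pose g (y : \bar R) : \bar R := (fine y ^+ 2)%:E.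
have g0 y : 0 <= g y by rewrite lee_fin sqr_ge0.
have mg : measurable_fun setT g.
  by apply/measurable_EFinP; exact (measurableT_comp m2 (fine_measurable measurableT)).
apply: (@le_trans _ _ (\int[P]_w (g (N w) * (\1_V w : R)%:E))).
  by apply: ge0_le_integral_gen => w; rewrite -?EFinM// lee_fin mulr_ge0 ?sqr_ge0.
apply: (le_trans (le_integral_mrestr P mV _ _)).
- by move=> w; exact: g0.
- exact: measurableT_comp mg mN.
have PV0 : (0 <= fine (P V))%R by rewrite fine_ge0.
have PVE : P V = (fine (P V))%:E by rewrite fineK// fin_num_measure.
rewrite (eq_dist_integral (m2 := mscale (NngNum PV0) P) mN mN mg g0).
  rewrite ge0_integral_mscale//; last exact: measurableT_comp mg mN.
  rewrite /= -PVE (rho2E P) -(integral_npts_box mcnt stat u m2)//.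
  by move=> y; exact: sqr_ge0.
move=> S mS; rewrite /= /mscale /mrestr /= -PVE muleC.
apply: (indep (borelV_box u 2^-1) (borelV_box v r)).
- exact: box_separated sep.
- exact: sig_restr_cnt.
- exact: sig_restr_no_pts.
Qed.

(** Two copies of [Lam l], centred at the points with all coordinates 2l and all coordinates -2l,
    lie in [Lam (3 * l)] at distance at least 2l >= L. *)
Lemma no_pts_Lam3 l : (0 <= l)%R -> (L <= l)%R ->
  P (no_pts (Lam (3 * l))) <= P (no_pts (Lam l)) * P (no_pts (Lam l)).
Proof.
move=> l0 Ll; set c : 'rV[R]_d := const_mx (2 * l)%R.
rewrite -[X in _ <= X * _](prob_no_pts_box stat c l).
rewrite -[X in _ <= _ * X](prob_no_pts_box stat (- c)%R l).
have sep a b : box c l a -> box (- c)%R l b -> (L <= enorm (a - b))%R.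
  by apply: (@box_separated _ _ _ _ (Ordinal d0)); rewrite !mxE ger0_norm; lra.
rewrite -(indep (borelV_box c l) (borelV_box (- c)%R l) sep
  (@sig_restr_no_pts _) (@sig_restr_no_pts _)).
have mb u : measurable (no_pts (box u l)) := measurable_no_pts mcnt (borelV_box u l).
apply: le_measure; rewrite ?inE//.
- by rewrite LamE; exact: (measurable_no_pts mcnt (borelV_box _ _)).
- exact: measurableI.
by move=> w h; split; apply: subset_no_pts h => z hz i; have := hz i;
  rewrite !mxE !ler_norml; lra.
Qed.

Hypothesis L0 : (0 < L)%R.
Hypothesis nonempty : P [set w | pts w = set0] = 0.

(** Continuity from above: the events decrease to emptiness of the whole process, which is null. *)
Lemma no_pts_Lam_small (e : R) : (0 < e)%R ->
  exists2 l : R, (1 <= l)%R & P (no_pts (Lam l)) <= e%:E.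
Proof.
move=> e0; pose F n := no_pts (Lam n%:R).
have mF n : measurable (F n).
  by rewrite /F LamE; exact: (measurable_no_pts mcnt (borelV_box _ _)).
have FE : \bigcap_n F n = [set w | pts w = set0].
  apply/seteqP; split => w /= h; last first.
    by move=> n _; apply/cnt_eq0P; rewrite h set0I.
  rewrite -subset0 => x px.
  have /cnt_eq0P := h (Num.truncn (enorm x)).+1 I; rewrite -subset0; apply; split=> //.
  move=> i; rewrite (le_trans (coord_le_enorm _ _))// ltW//.
  exact: (andP (truncn_itv (enorm_ge0 _))).2.
have cv : P (F n) @[n --> \oo] --> 0.
  rewrite -nonempty -FE; apply: nonincreasing_cvg_mu => //.
  - by rewrite ltey_eq fin_num_measure.
  - exact: bigcapT_measurable.
  - move=> m n mn; apply/subsetPset; apply: subset_no_pts => z hz i.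
    by rewrite (le_trans (hz i))// ler_nat.
have [n hn] : exists n, P (F n) <= e%:E.
  apply: contrapT => h; suff : e%:E <= 0 by rewrite lee_fin leNgt e0.
  rewrite -(cvg_lim _ cv)//; apply: lime_ge; first exact: cvgP cv.
  by apply: nearW => n; rewrite ltW// ltNge; apply/negP => hn; apply: h; exists n.
exists n.+1%:R; first by rewrite ler1n.
apply: le_trans hn; apply: le_measure; rewrite ?inE//.
  exact: (mF n.+1).
apply: subset_no_pts => z hz i; by rewrite (le_trans (hz i))// ler_nat.
Qed.

(** Start from a scale where the probability is at most 3^(-alpha). By [no_pts_Lam3] each tripling
    of the radius then gains another factor 3^(-alpha), which is decay of order l^(-alpha). The
    induction is on the number of triplings. *)
Lemma range_condC (alpha : R) : (0 < alpha)%R -> condC P pts alpha.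
Proof.
move=> a0.
have [l1 l11 hl1] : exists2 l, (1 <= l)%R & P (no_pts (Lam l)) <= (3 `^ (- alpha))%:E.
  by apply: no_pts_Lam_small; rewrite powR_gt0.
have mLam l : measurable (no_pts (Lam l)).
  by rewrite LamE; exact: (measurable_no_pts mcnt (borelV_box _ _)).
have mono l l' : (l <= l')%R -> P (no_pts (Lam l')) <= P (no_pts (Lam l)).
  move=> ll'; apply: le_measure; rewrite ?inE//; apply: subset_no_pts => z hz i.
  by rewrite (le_trans (hz i)).
(* Beyond 3 l2, the radius l / 3 exceeds both the starting scale and the range; up to 3 l2, [kappa]
   makes the bound at least 1. *)
pose l2 := Num.max l1 L; pose kappa := ((3 * l2) `^ alpha)%R.
have l21 : (1 <= l2)%R by rewrite le_max l11.
have k0 : (0 < kappa)%R by rewrite powR_gt0//; lra.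
exists kappa; split => //.
suff main n l : (1 <= l)%R -> (l <= 3 ^+ n * (3 * l2))%R ->
    P (no_pts (Lam l)) <= (kappa * l `^ (- alpha))%:E.
  move=> l hl; apply: (main (Num.truncn l).+1) => //.
  have l0 : (0 <= l)%R by lra.
  have /andP[_ /ltW lt] := truncn_itv l0; apply: (le_trans lt).
  apply: (@le_trans _ _ (3 ^+ (Num.truncn l).+1 * 1)%R).
    by rewrite mulr1 -natrX ler_nat ltnW// ltn_expl.
  by rewrite ler_wpM2l ?exprn_ge0//; lra.
elim: n l => [|n IH] l hl.
  rewrite expr0 mul1r => ll2; apply: (le_trans (probability_le1 _ (mLam l))).
  rewrite lee_fin powRN ler_pdivlMr ?mul1r ?powR_gt0//; last lra.
  by rewrite ge0_ler_powR ?nnegrE ?(ltW a0)//; lra.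
move=> ll2; have [|l2l] := leP l (3 * l2)%R.
  move=> h; apply: IH => //; apply: (le_trans h).
  by rewrite ler_peMl ?exprn_ege1//; lra.
have e : l = (3 * (l / 3))%R by field.
have h2 : (l2 <= l / 3)%R by lra.
have h1 : (l1 <= l / 3)%R by rewrite (le_trans _ h2)// le_max lexx.
have hL : (L <= l / 3)%R by rewrite (le_trans _ h2)// le_max lexx orbT.
rewrite e; apply: (le_trans (no_pts_Lam3 _ hL)); first lra.
apply: (@le_trans _ _ ((3 `^ (- alpha))%:E * (kappa * (l / 3) `^ (- alpha))%:E)).
  apply: lee_pmul => //; first exact: le_trans (mono _ _ h1) hl1.
  by apply: IH; [lra|move: ll2; rewrite exprS -mulrA; move: (_ ^+ n * _)%R => t; lra].
rewrite -EFinM lee_fin mulrCA (powRM (x := 3) (y := (l / 3)%R))//; lra.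
Qed.

Lemma range_decoupled (alpha : R) : (0 < alpha)%R -> rho P pts 2 < +oo ->
  decoupled P pts alpha.
Proof.
move=> a0 r2; have [kappa [k0 hk]] := condC_no_pts stat (range_condC a0).
have r0 : 0 <= rho P pts 2 by apply: integral_ge0 => w _; rewrite lee_fin powR_ge0.
have rE : rho P pts 2 = (fine (rho P pts 2))%:E by rewrite fineK// ge0_fin_numE.
(* From 2 + 2 L <= l follow both L + 1/2 + l/2 <= l, the separation needed for independence, and 2
   <= l. *)
exists (kappa * fine (rho P pts 2))%R, (2 + 2 * L)%R; split.
- by rewrite mulr_ge0 ?fine_ge0 ?(ltW k0).
- by have := L0; lra.
move=> l u v hl [i hi].
apply: (le_trans (@indep_second_moment u v (l / 2) i _)); first by have := L0; lra.
rewrite rE mulrAC EFinM lee_wpmul2r ?lee_fin ?fine_ge0//.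
by apply: hk; have := L0; lra.
Qed.

End finite_range.

End assoc_and_range.

(** * Holes in an orthant *)

Section pair_moments.
Context {R : realType} {d : nat} {dO : measure_display} {O : measurableType dO}.
Variables (P : probability O R) (pts : O -> set 'rV[R]_d).
Hypothesis lf : forall w, locfin (pts w).
Hypothesis mcnt : forall A, borelV A -> measurable_fun setT (fun w => cnt (pts w) A).
Local Open Scope ereal_scope.
Local Notation npts := (num_pts pts).
Local Notation no_pts := (no_pts pts).

Lemma npts_cover (K : finType) w A (B : K -> set 'rV[R]_d) :
  Defs.bounded_set A -> (forall k, Defs.bounded_set (B k)) ->
  A `<=` [set x | exists k, B k x] -> (npts w A <= \sum_k npts w (B k))%R.
Proof.
move=> bA bB /(cnt_cover (pts w)).
have nE C : Defs.bounded_set C -> cnt (pts w) C = (npts w C)%:E.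
  by move=> bC; rewrite /num_pts cnt_fineK.
rewrite nE// (eq_bigr (fun k => (npts w (B k))%:E)) => [|k _]; last exact: nE.
by rewrite sumEFin lee_fin.
Qed.

(** [Lam N] is covered by (2N)^d unit cubes, and q q' <= (q^2 + q'^2) / 2 reduces each product to
    second moments in single cubes. *)
Lemma pair_moment_le U (N : nat) (K : R) : measurable U -> (0 < N)%N ->
  (forall u, \int[P]_w (npts w (box u 2^-1) ^+ 2 * \1_U w)%:E <= K%:E) ->
  \int[P]_w (npts w cube01 * npts w (Lam N%:R) * \1_U w)%:E
    <= (((2 * N) ^ d)%:R * K)%:E.
Proof.
move=> mU N0 hK.
pose F u w := (2^-1 * (npts w (box u 2^-1) ^+ 2 * \1_U w))%R : R.
have F0 u w : (0 <= F u w)%R by rewrite /F mulr_ge0 ?invr_ge0 ?ler0n// mulr_ge0 ?sqr_ge0.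
have mF u : measurable_fun setT (fun w => (F u w)%:E).
  apply/measurable_EFinP; apply: measurable_funM => //; apply: measurable_funM.
    by apply: measurable_funX; exact (measurable_npts mcnt (borelV_box u 2^-1)).
  exact: measurable_indic.
have IF u : \int[P]_w (F u w)%:E <= (2^-1 * K)%:E.
  rewrite /F; under eq_integral do rewrite EFinM.
  rewrite ge0_integralZl_EFin//; last 2 first.
  - by move=> w _; rewrite lee_fin mulr_ge0 ?sqr_ge0.
  - apply/measurable_EFinP; apply: measurable_funM.
      by apply: measurable_funX; exact (measurable_npts mcnt (borelV_box u 2^-1)).
    exact: measurable_indic.
  by rewrite EFinM lee_wpmul2l// lee_fin.
pose c0 : 'rV[R]_d := (const_mx 2^-1)%R.
pose G w : \bar R := \sum_(k : {ffun 'I_d -> 'I_(2 * N)})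
    ((F c0 w)%:E + (F (@grid_pt R d N k) w)%:E).
apply: (@le_trans _ _ (\int[P]_w G w)).
  apply: ge0_le_integral_gen => w.
    by rewrite lee_fin mulr_ge0// mulr_ge0 ?npts_ge0.
  rewrite /G; under eq_bigr do rewrite -EFinD; rewrite sumEFin lee_fin cube01E -/c0.
  apply: (@le_trans _ _ (npts w (box c0 2^-1) *
      (\sum_(k : {ffun 'I_d -> 'I_(2 * N)}) npts w (box (@grid_pt R d N k) 2^-1)) * \1_U w)%R).
    rewrite ler_wpM2r// ler_wpM2l ?npts_ge0//; apply: npts_cover.
    - by rewrite LamE; exact: bounded_box.
    - by move=> k; exact: bounded_box.
    - exact: Lam_grid.
  rewrite mulr_sumr mulr_suml; apply: ler_sum => k _; rewrite /F.
  rewrite -mulrDr -mulrDl mulrA ler_wpM2r//.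
  have := sqr_ge0 (npts w (box c0 2^-1) - npts w (box (@grid_pt R d N k) 2^-1)); nra.
rewrite ge0_integral_sum//; last 2 first.
- by move=> k; exact: emeasurable_funD.
- by move=> k w _; rewrite -EFinD lee_fin addr_ge0.
apply: (@le_trans _ _ (\sum_(k : {ffun 'I_d -> 'I_(2 * N)}) K%:E)).
  apply: lee_sum => k _; rewrite ge0_integralD//; try by move=> w _; rewrite lee_fin.
  have -> : K%:E = (2^-1 * K)%:E + (2^-1 * K)%:E by rewrite -EFinD; congr EFin; field.
  exact: leeD.
by rewrite (sumEFin _ _ (fun=> K)) lee_fin sumr_const card_ffun !card_ord mulr_natl.
Qed.

(* Some orthant has no point of the process at distance of order [l]; the two
   test boxes in each orthant are so far apart that no unit cube is near both. *)
Definition hole (l : R) : set O :=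
  [set w | exists s, no_pts (orthant_box l (2 * l) s) w /\
                     no_pts (orthant_box (4 * l) (5 * l) s) w].

Let hole_at l s := no_pts (orthant_box l (2 * l) s) `&` no_pts (orthant_box (4 * l) (5 * l) s).

Let measurable_hole_at l s : measurable (hole_at l s).
Proof.
by apply: measurableI; exact (measurable_no_pts mcnt (borelV_box _ _)).
Qed.

Lemma measurable_hole l : measurable (hole l).
Proof.
rewrite (_ : hole l = \big[setU/set0]_s hole_at l s).
  by apply: bigsetU_measurable.
rewrite -bigcup_seq; apply/seteqP; split => w [s].
  by move=> h; exists s => //=; rewrite mem_index_enum.
by move=> _ h; exists s.
Qed.

(** Union bound over the 2^d orthants; in each, one of the two test boxes is far from the given unit
    cube and [decoupled] applies to it. *)
Lemma hole_moment_le beta : (0 < d)%N -> decoupled P pts beta ->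
  exists C l0 : R, [/\ (0 <= C)%R, (1 <= l0)%R & forall (l : R) (N : nat),
    (l0 <= l)%R -> (0 < N)%N ->
    \int[P]_w (npts w cube01 * npts w (Lam N%:R) * \1_(hole l) w)%:E
      <= (((2 * N) ^ d)%:R * (C * l `^ (- beta)))%:E].
Proof.
move=> d0 [C [l0 [C0 l01 hC]]].
exists (#|{ffun 'I_d -> bool}|%:R * C)%R, l0; split => //; first by rewrite mulr_ge0.
move=> l N ll0 N0.
have single s u : \int[P]_w (npts w (box u 2^-1) ^+ 2 * \1_(hole_at l s) w)%:E
    <= (C * l `^ (- beta))%:E.
  pose i := Ordinal d0.
  have le (A : set O) : hole_at l s `<=` A ->
     \int[P]_w (npts w (box u 2^-1) ^+ 2 * \1_(hole_at l s) w)%:E <=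
     \int[P]_w (npts w (box u 2^-1) ^+ 2 * \1_A w)%:E.
    move=> sA; apply: ge0_le_integral_gen => w.
      by rewrite lee_fin mulr_ge0 ?sqr_ge0.
    rewrite lee_fin ler_wpM2l ?sqr_ge0// !indicE.
    have [/set_mem/sA/mem_set->//|_] := boolP (w \in hole_at l s).
    by case: (_ \in _).
  have e1 : orthant_box l (2 * l) s = box (((l + 2 * l) / 2) *: @sgnv R d s)%R (l / 2).
    by rewrite /orthant_box; congr box; field.
  have e2 : orthant_box (4 * l) (5 * l) s =
      box (((4 * l + 5 * l) / 2) *: @sgnv R d s)%R (l / 2).
    by rewrite /orthant_box; congr box; field.
  have e t : ((t *: @sgnv R d s) ord0 i = t * @sgnv R d s ord0 i)%R by rewrite [LHS]mxE.
  (* In this coordinate the centres are at 3l/2 and 9l/2 up to a common sign; being 3l apart, they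
     cannot both be within l of u. *)
  have [far|near] := leP l `|u ord0 i - (((l + 2 * l) / 2) *: @sgnv R d s) ord0 i|%R.
    apply: (le_trans (le (no_pts (orthant_box l (2 * l) s)) _)); first by move=> w [].
    by rewrite e1; apply: hC => //; exists i.
  apply: (le_trans (le (no_pts (orthant_box (4 * l) (5 * l) s)) _)); first by move=> w [].
  rewrite e2; apply: hC => //; exists i; move: near; rewrite !e.
  have l1 : (0 <= l)%R by lra.
  case: (@sgnv_cases R d s i) => ->; rewrite ?mulr1 ?mulrN1 ltr_norml => /andP[h1 h2];
    rewrite ler_normr; apply/orP; [right|left]; lra.
apply: (@le_trans _ _ (\int[P]_w (\sum_(s : {ffun 'I_d -> bool})
    (npts w cube01 * npts w (Lam N%:R) * \1_(hole_at l s) w)%:E))).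
  apply: ge0_le_integral_gen => w; first by rewrite lee_fin mulr_ge0// mulr_ge0 ?npts_ge0.
  rewrite sumEFin lee_fin -mulr_sumr ler_wpM2l ?mulr_ge0 ?npts_ge0// indicE.
  have [/set_mem[s hs]|_] := boolP (w \in hole l); last exact: sumr_ge0.
  rewrite (bigD1 s)//= indicE mem_set//= lerDl; exact: sumr_ge0.
rewrite ge0_integral_sum//; last 2 first.
- move=> s; apply/measurable_EFinP; apply: measurable_funM; last exact: measurable_indic.
  apply: measurable_funM; first exact (measurable_npts mcnt (@borel_cube01 R d)).
  by rewrite LamE; exact (measurable_npts mcnt (borelV_box _ _)).
- by move=> s w _; rewrite lee_fin mulr_ge0// mulr_ge0 ?npts_ge0.
apply: (@le_trans _ _ (\sum_(s : {ffun 'I_d -> bool})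
    (((2 * N) ^ d)%:R * (C * l `^ (- beta)))%:E)).
  by apply: lee_sum => s _; apply: pair_moment_le.
rewrite (sumEFin _ _ (fun=> (((2 * N) ^ d)%:R * (C * l `^ (- beta)))%R)) lee_fin sumr_const -[X in (X <= _)%R]mulr_natl.
by rewrite mulrCA !mulrA lexx.
Qed.

(** Serves the innermost ball, where no hole is forced; the event [setT] gives it the form of
    [palm_pair_le]. *)
Lemma pair_moment_lty (N : nat) : (0 < N)%N ->
  (forall u v r (S : set (\bar R)), measurable S ->
    P [set w | S (cnt (pts w) (box u r))] = P [set w | S (cnt (pts w) (box v r))]) ->
  rho P pts 2 < +oo ->
  \int[P]_w (npts w cube01 * npts w (Lam N%:R) * \1_setT w)%:E < +oo.
Proof.
move=> N0 stat r2.
have r0 : 0 <= rho P pts 2 by apply: integral_ge0 => w _; rewrite lee_fin powR_ge0.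
have rE : rho P pts 2 = (fine (rho P pts 2))%:E by rewrite fineK// ge0_fin_numE.
apply: (@le_lt_trans _ _ (((2 * N) ^ d)%:R * fine (rho P pts 2))%:E); last exact: ltry.
apply: pair_moment_le => // u; rewrite -rE (rho2E P).
have m2 : measurable_fun setT (fun y : R => y ^+ 2)%R by exact: exprn_measurable.
rewrite -(integral_npts_box mcnt stat u m2); last by move=> y; exact: sqr_ge0.
by apply: ge0_le_integral_gen => w; rewrite lee_fin indicE in_setT mulr1 ?sqr_ge0.
Qed.

End pair_moments.

Definition pointed_config (R : realType) (d : nat) : measurableType _ :=
  g_sigma_algebraType [set E : set (set 'rV[R]_d * 'rV[R]_d) |
    exists D B, [/\ N_gen D, borelV B & E = D `*` B]].

Lemma N_sig_xE (R : realType) (d : nat) :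
  @N_sig_x R d = @measurable _ (pointed_config R d).
Proof. by []. Qed.

Lemma measurable_sumsq (R : realType) (d : nat) :
  measurable_fun setT (fun v : euc R d => \sum_(i < d) (v : 'rV[R]_d) ord0 i ^+ 2).
Proof.
apply: measurable_sum => i; apply: measurable_funX.
apply: (measurability _ (RGenOInfty.measurableE R)) => _ [_ [a ->] <-].
rewrite setTI (_ : _ @^-1` _ = ~` [set v : 'rV[R]_d | v ord0 i <= a]).
  exact (borelVC (borelV_coord i a)).
apply/seteqP; split => v /=; rewrite in_itv/= andbT ltNge; first by move/negP.
by move=> /negP.
Qed.

Lemma borelV_enorm_le (R : realType) (d : nat) (a : R) : 0 <= a ->
  borelV [set v : 'rV[R]_d | enorm v <= a].
Proof.
move=> a0; have := @measurable_sumsq R d measurableT _ (measurable_itv `]-oo, a ^+ 2]).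
rewrite setTI (_ : _ @^-1` _ = [set v : 'rV[R]_d | enorm v <= a])//.
by apply/seteqP; split => v /=; rewrite in_itv/= enorm_le.
Qed.

Lemma nneseries_geometric_lty (R : realType) (t : nat -> \bar R) (B q : R) :
  0 <= B -> 0 < q -> q < 1 -> (forall n, 0 <= t n)%E ->
  (forall n, t n <= (B * q ^+ n)%:E)%E -> (\sum_(n <oo) t n < +oo)%E.
Proof.
move=> B0 q0 q1 t0 tB; apply: (@le_lt_trans _ _ (B / (1 - q))%:E); last exact: ltry.
apply: lime_le; first by apply: is_cvg_nneseries => n _ _.
apply: nearW => n; apply: (@le_trans _ _ (\sum_(0 <= i < n) (B * q ^+ i)%:E)%E).
  by apply: lee_sum => i _.
rewrite sumEFin lee_fin ler_pdivlMr ?subr_gt0//.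
rewrite (_ : _ * (1 - q) = B * (1 - q ^+ n)).
  by rewrite ler_piMr// lerBlDr lerDl exprn_ge0// ltW.
elim: n => [|n IH]; first by rewrite big_geq// expr0 subrr !(mul0r, mulr0).
by rewrite big_nat_recr//= mulrDl IH exprS; ring.
Qed.

(** * Dyadic annuli *)

Section config_sets.
Context {R : realType} {d : nat}.

Lemma N_sig_x_cnt0 (A : set 'rV[R]_d) : borelV A ->
  N_sig_x [set p : set 'rV[R]_d * 'rV[R]_d | cnt p.1 A = 0%E].
Proof.
move=> mA; apply: sub_gen_smallest; exists [set xi | cnt xi A = 0%E], setT; split.
- by exists A, [set 0%E]; split => //; exact: emeasurable_set1.
- exact: borelV_setT.
- by apply/seteqP; split => -[xi y] //= [].
Qed.

Lemma N_sig_x_snd (B : set 'rV[R]_d) : borelV B ->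
  N_sig_x [set p : set 'rV[R]_d * 'rV[R]_d | B p.2].
Proof.
move=> mB; apply: sub_gen_smallest; exists setT, B; split => //.
  exists setT, setT; split; [exact: borelV_setT|exact: measurableT|].
  by apply/seteqP; split.
by apply/seteqP; split => -[xi y] //= [].
Qed.

(** A property of the configuration alone, so that it may enter the sets on which the conditional
    expectation is tested. *)
Definition sector_empty (l : R) (xi : set 'rV[R]_d) : Prop :=
  exists s, cnt xi (orthant_box (l / 2) (6 * l) s) = 0%E.

Lemma N_sig_x_sector_empty l :
  N_sig_x [set p : set 'rV[R]_d * 'rV[R]_d | sector_empty l p.1].
Proof.
rewrite (_ : [set p | _] = \big[setU/set0]_(s : {ffun 'I_d -> bool})
    [set p : set 'rV[R]_d * 'rV[R]_d | cnt p.1 (orthant_box (l / 2) (6 * l) s) = 0%E]).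
  rewrite N_sig_xE; apply: bigsetU_measurable => s _.
  exact (N_sig_x_cnt0 (borelV_box _ _)).
rewrite -bigcup_seq; apply/seteqP; split => p [s].
  by move=> h; exists s => //=; rewrite mem_index_enum.
by move=> _ h; exists s.
Qed.

(** Moving the viewpoint within the unit cube changes coordinates by at most 1 <= l/2, so the ranges
    [l, 2l] and [4l, 5l] stay inside [l/2, 6l]. *)
Lemma hole_of_sector_empty (dO : measure_display) (O : measurableType dO)
    (pts : O -> set 'rV[R]_d) (l : R) w x : 2 <= l -> cube01 x ->
  sector_empty l [set y - x | y in pts w] -> hole pts l w.
Proof.
move=> l2 cx [s]; rewrite cnt_translate => h.
by exists s; split; apply: (subset_no_pts (B := [set z | orthant_box (l / 2) (6 * l) s (z - x)])) => //;
  move=> z /orthant_boxP hz /=; apply/orthant_boxP => i; have := hz i; have := cx i;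
  rewrite !mxE; case: (@sgnv_cases R d s i); rewrite mxE => ->; lra.
Qed.

Lemma DTedge_sector_empty xi y (l : R) : (0 < d)%N -> 0 < l ->
  DTedge xi 0 y -> 72 * d%:R * l < enorm y -> sector_empty l xi.
Proof.
move=> d0 l0 e; rewrite ltNge => /negP h; apply: contrapT => ns; apply: h.
apply: (Delaunay_edge_bound d0 l0 e) => s; apply: cnt_neq0 => h0.
by apply: ns; exists s.
Qed.

End config_sets.

Section annuli.
Context {R : realType} {d : nat}.
Variable b : nat.
Hypothesis d0 : (0 < d)%N.
Hypothesis b2 : (2 <= b)%N.

Definition dyadic_scale n : nat := b * 2 ^ n.
(** The bound of [Delaunay_edge_bound] at this scale, kept a natural number for the grid of unit
    cubes. *)
Definition outer_radius n : nat := 72 * d * dyadic_scale n.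

Lemma dyadic_scale_gt0 n : (0 < dyadic_scale n)%N.
Proof. by rewrite muln_gt0 expn_gt0 (ltn_trans _ b2). Qed.

Lemma leq_b_scale n : (b <= dyadic_scale n)%N.
Proof. by rewrite leq_pmulr// expn_gt0. Qed.

Lemma outer_radius_gt0 n : (0 < outer_radius n)%N.
Proof. by rewrite /outer_radius muln_gt0 dyadic_scale_gt0 muln_gt0 d0. Qed.

Lemma outer_radiusS n : outer_radius n.+1 = (2 * outer_radius n)%N.
Proof. by rewrite /outer_radius /dyadic_scale expnS (mulnCA b) mulnCA. Qed.

Lemma outer_radiusE n : (outer_radius n)%:R = 72 * d%:R * (dyadic_scale n)%:R :> R.
Proof. by rewrite /outer_radius !natrM. Qed.

Lemma ltn_outer_radius n : (n < outer_radius n)%N.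
Proof.
rewrite (leq_trans (ltn_expl n (isT : 1 < 2)%N))// /outer_radius /dyadic_scale mulnA.
by rewrite leq_pmull// !muln_gt0 d0 (ltn_trans _ b2).
Qed.

(** The empty sector is built in, since every Delaunay edge reaching the annulus forces one. Its
    scale is the one whose radius the edge exceeds, that of the inner boundary. *)
Definition annulus n : set (set 'rV[R]_d * 'rV[R]_d) :=
  if n is n'.+1 then
    [set p | [/\ (outer_radius n')%:R < enorm p.2, enorm p.2 <= (outer_radius n)%:R &
                 sector_empty (dyadic_scale n')%:R p.1]]
  else [set p | enorm p.2 <= (outer_radius 0)%:R].

Lemma N_sig_x_annulus n : N_sig_x (annulus n).
Proof.
case: n => [|n]; first exact (N_sig_x_snd (borelV_enorm_le (ler0n R (outer_radius 0)))).
rewrite (_ : annulus n.+1 = ~` [set p | enorm p.2 <= (outer_radius n)%:R] `&`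
    ([set p | enorm p.2 <= (outer_radius n.+1)%:R] `&` [set p | sector_empty (dyadic_scale n)%:R p.1])).
  rewrite N_sig_xE; apply: measurableI.
    apply: measurableC; exact (N_sig_x_snd (borelV_enorm_le (ler0n R (outer_radius n)))).
  apply: measurableI; last exact (N_sig_x_sector_empty _).
  exact (N_sig_x_snd (borelV_enorm_le (ler0n R (outer_radius n.+1)))).
apply/seteqP; split => p /=.
  by move=> [h1 h2 h3]; split => //; apply/negP; rewrite -ltNge.
by move=> [/negP h1 [h2 h3]]; split => //; rewrite ltNge.
Qed.

Lemma annulus_cover xi y : DTedge xi 0 y -> exists n, annulus n (xi, y).
Proof.
move=> e; have ex : exists n, enorm y <= (outer_radius n)%:R.
  exists (Num.truncn (enorm y)).+1; apply: ltW.
  have /andP[_ /lt_le_trans] := truncn_itv (enorm_ge0 y); apply.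
  by rewrite ler_nat ltnW// ltn_outer_radius.
(* Minimality of n gives the lower bound on |y| that forces the empty sector. *)
case: (ex_minnP ex) => -[|n] hn hmin; first by exists 0%N.
exists n.+1; split => //=.
  by rewrite ltNge; apply/negP => /hmin; rewrite ltnn.
apply: DTedge_sector_empty e _ => //; first by rewrite ltr0n dyadic_scale_gt0.
by rewrite -outer_radiusE ltNge; apply/negP => /hmin; rewrite ltnn.
Qed.

End annuli.

Lemma powR_nat_exp (R : realType) (e : R) (n : nat) :
  ((2 ^ n)%N%:R : R) `^ e = (2 `^ e) ^+ n.
Proof.
by rewrite natrX -powR_mulrn// -powRrM mulrC powRrM powR_mulrn ?powR_ge0.
Qed.

(** One term of the dyadic sum, with inner radius r and outer radius 2r. The powers (2r)^k and
    r^(-2) cancel up to a factor 4; what remains is l^zeta from [phi], l^d from the unit cubes and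
    l^(-beta) from the hole. *)
Lemma annulus_term_bound (R : realType) (d k : nat) (C0 zeta C beta l r : R) :
  (k <= 2)%N -> 0 <= C0 -> 0 <= C -> 0 <= zeta -> 1 <= l -> 0 < r ->
  r = 72 * d%:R * l -> 1 <= r ->
  (2 * r) ^+ k * (C0 * (2 * r) `^ zeta / r ^+ 2) *
    ((2 * (2 * r + 1)) ^+ d * (C * l `^ (- beta))) <=
  4 * C0 * C * (144 * d%:R) `^ zeta * (576 * d%:R) ^+ d * l `^ (zeta + d%:R - beta).
Proof.
move=> k2 hC0 hC z0 l1 r0 rE r1.
have l0 : 0 < l by lra.
have d0 : 0 <= d%:R :> R by [].
have -> : l `^ (zeta + d%:R - beta) = l `^ zeta * l ^+ d * l `^ (- beta).
  by rewrite -powR_mulrn ?(ltW l0)// -!powRD ?(gt_eqF l0) ?implybT.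
have h1 : (2 * r) ^+ k / r ^+ 2 <= 4.
  rewrite ler_pdivrMr ?exprn_gt0//.
  apply: (@le_trans _ _ ((2 * r) ^+ 2)); last by rewrite exprMn; lra.
  by apply: ler_weXn2l => //; lra.
have h2 : (2 * r) `^ zeta = (144 * d%:R) `^ zeta * l `^ zeta.
  by rewrite rE -powRM ?mulr_ge0 ?(ltW l0)//; congr (_ `^ _); ring.
(* As 1 <= r, 2 (2r + 1) <= 8r, and 8 . 72 = 576. *)
have h3 : (2 * (2 * r + 1)) ^+ d <= (576 * d%:R) ^+ d * l ^+ d.
  rewrite -exprMn; apply: lerXn2r; rewrite ?nnegrE; first lra.
    exact (mulr_ge0 (mulr_ge0 (ler0n R 576) (ler0n R d)) (ltW l0)).
  by rewrite rE in r1 *; lra.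
have h4 : 0 <= (2 * r) ^+ k / r ^+ 2 by rewrite divr_ge0// exprn_ge0//; lra.
rewrite h2; set Z := (144 * d%:R) `^ zeta; set Y := l `^ zeta; set B := l `^ (- beta).
have Z0 : 0 <= Z by exact: powR_ge0.
have Y0 : 0 <= Y by exact: powR_ge0.
have B0 : 0 <= B by exact: powR_ge0.
set X := (2 * (2 * r + 1)) ^+ d in h3 *; have X0 : 0 <= X by rewrite exprn_ge0//; lra.
set D := (576 * d%:R) ^+ d in h3 *; set Ld := l ^+ d in h3 *.
rewrite (_ : (2 * r) ^+ k * (C0 * (Z * Y) / r ^+ 2) * (X * (C * B)) =
  ((2 * r) ^+ k / r ^+ 2) * X * (C0 * C * Z * Y * B)); last by ring.
rewrite (_ : 4 * C0 * C * Z * D * (Y * Ld * B) = 4 * (D * Ld) * (C0 * C * Z * Y * B));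
  last by ring.
apply: ler_wpM2r; first by rewrite !mulr_ge0.
exact: ler_pM.
Qed.

(** * Bounds under the Palm measure *)

Section Palm_bounds.
Context {R : realType} {d : nat} {dO : measure_display} {O : measurableType dO}.
Variables (P : probability O R) (theta : 'rV[R]_d -> O -> O) (pts : O -> set 'rV[R]_d).
Hypothesis mtheta : forall U, measurable U -> prod_sig (O:=O) [set p | U (theta p.1 p.2)].
Hypothesis lf : forall w, locfin (pts w).
Hypothesis mcnt : forall A, borelV A -> measurable_fun setT (fun w => cnt (pts w) A).
Local Open Scope ereal_scope.
Local Notation V := (euc R d).
Local Notation palm := (palm_sum P theta pts).
Local Notation npts := (num_pts pts).

(** Points at relative position in [Lam N] from a point of the unit cube lie in [Lam N.+1], and all
    terms vanish off U; the double sum is thus at most a product of two counts. *)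
Lemma palm_pair_le (Os : set O) (D : set (set 'rV[R]_d * 'rV[R]_d)) (U : set O) (N : nat) :
  measurable Os -> P Os = 1 ->
  (forall w, Os w -> forall x, pts (theta x w) = [set y - x | y in pts w]%R) ->
  measurable U ->
  (forall xi y, D (xi, y) -> Lam N%:R y) ->
  (forall w x y, Os w -> cube01 x -> D (pts (theta x w), y) -> U w) ->
  palm (fun w => \esum_(y in pts w) (\1_D (pts w, y) : R)%:E)
    <= \int[P]_w (npts w cube01 * npts w (Lam N.+1%:R) * \1_U w)%:E.
Proof.
move=> mOs POs hOs mU DN DU.
have POC : P (~` Os) = 0 by rewrite probability_setC// POs subee.
apply: (@ae_le_integral_gen _ _ _ P (~` Os)).
- exact: measurableC.
- exact: POC.
- by move=> w; apply: esum_ge0 => x _; apply: esum_ge0 => y _; rewrite lee_fin.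
- by move=> w; rewrite lee_fin mulr_ge0// mulr_ge0 ?npts_ge0.
- apply/measurable_EFinP; apply: measurable_funM; last exact: measurable_indic.
  apply: measurable_funM; first exact (measurable_npts mcnt (@borel_cube01 R d)).
  by rewrite LamE; exact (measurable_npts mcnt (borelV_box _ _)).
move=> w /contrapT Ow.
have bL : Defs.bounded_set (Lam N.+1%:R : set 'rV[R]_d) by exists N.+1%:R.
apply: (@le_trans _ _ (\esum_(x in pts w `&` cube01)
    ((npts w (Lam N.+1%:R) * \1_U w)%:E * 1))); last first.
  rewrite esumZl//; last by rewrite mulr_ge0 ?npts_ge0.
  rewrite [\esum_(x in _) _](_ : _ = (npts w cube01)%:E).
    by rewrite -EFinM lee_fin mulrC mulrA.
  by rewrite /num_pts cnt_fineK//; exact: bounded_cube01.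
apply: le_esum => x [ptx cx]; rewrite mule1 hOs// esum_translate -hOs//.
rewrite indicE; have [_|/negP nU] := boolP (w \in U); last first.
  rewrite mulr0 esum1// => z _; rewrite indicE memNset// => h; apply: nU.
  by apply: mem_set; exact: DU h.
rewrite mulr1 /num_pts cnt_fineK// /cnt -esum_indic; apply: le_esum => z _.
rewrite lee_fin !indicE; have [/set_mem h|_] := boolP (_ \in D); last by rewrite ler0n.
rewrite mem_set// => i; have := DN _ _ h i; have := cx i.
by rewrite !mxE !ler_norml -natr1; lra.
Qed.

Section conductances.
Variable c : 'rV[R]_d -> 'rV[R]_d -> O -> R.
Hypothesis c0 : forall x y w, (0 <= c x y w)%R.
Hypothesis csupp : forall x y w, ~ DTedge (pts w) x y -> c x y w = 0%R.
Hypothesis mc : forall S : set R, measurable S ->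
  prod2_sig (O:=O) [set p | S (c p.1.1 p.1.2 p.2)].

Lemma measurable_conductance : measurable_fun setT (fun p : V * O => c 0%R p.1 p.2).
Proof.
by move=> _ S mS; rewrite setTI; have := prod2_sig_section 0%R (mc mS).
Qed.

Lemma measurable_config_indic D : N_sig_x D ->
  measurable_fun setT (fun p : V * O => (\1_D (pts p.2, p.1) : R)).
Proof.
move=> /(N_sig_x_preimage mcnt) mD.
rewrite (_ : (fun p => _) = \1_[set p : V * O | D (pts p.2, p.1)]).
  exact: measurable_indic.
by apply/funext => p; rewrite !indicE; congr ((nat_of_bool _)%:R);
  apply/idP/idP => /set_mem h; exact: mem_set.
Qed.

Lemma measurable_enormX (k : nat) : (k = 0%N \/ k = 2%N) ->
  measurable_fun setT (fun p : V * O => enorm (p.1 : 'rV[R]_d) ^+ k)%R.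
Proof.
move=> [->|->].
  rewrite (_ : (fun p => _) = cst 1%R); first exact: measurable_cst.
  by apply/funext => p; rewrite expr0.
rewrite (_ : (fun p => _) = fun p : V * O => (\sum_(i < d) (p.1 : 'rV[R]_d) ord0 i ^+ 2)%R); last first.
  by apply/funext => p; rewrite sqr_enorm.
exact: (measurableT_comp (@measurable_sumsq R d) measurable_fst).
Qed.

(** The sum over all points is what makes [lamk] measurable without any statement about the Delaunay
    graph. *)
Lemma lamkE k w : lamk pts c k w = \esum_(y in pts w) (c 0%R y w * enorm y ^+ k)%:E.
Proof.
rewrite /lamk (_ : [set x | _] = pts w `&` [set x | DTedge (pts w) 0%R x]); last first.
  by apply/seteqP; split => [x h|x []//]; split => //; case: h.
rewrite esum_mkcondr; apply: eq_esum => y _.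
have [//|/negP h] := boolP (y \in _).
by rewrite csupp ?mul0r// => e; apply: h; exact: mem_set.
Qed.

Lemma measurable_lamk k : (k = 0%N \/ k = 2%N) -> measurable_fun setT (lamk pts c k).
Proof.
move=> hk; rewrite (_ : lamk pts c k = fun w => \esum_(y in pts w) (c 0%R y w * enorm y ^+ k)%:E).
  apply: (measurable_pts_sum lf mcnt (F := fun p : V * O => (c 0%R p.1 p.2 * enorm p.1 ^+ k)%:E)).
    by move=> p; rewrite lee_fin mulr_ge0// exprn_ge0// enorm_ge0.
  apply/measurable_EFinP; apply: measurable_funM; first exact: measurable_conductance.
  exact: measurable_enormX.
by apply/funext => w; rewrite lamkE.
Qed.

Lemma E0_palm_inj f g : 0 < intensity P pts -> intensity P pts < +oo ->
  E0 P pts theta f = E0 P pts theta g -> palm f = palm g.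
Proof.
move=> i0 ioo h.
have fin : (0 < fine (intensity P pts))%R by rewrite fine_gt0// i0.
have E f' : palm f' = (fine (intensity P pts))%:E * E0 P pts theta f'.
  by rewrite /E0 muleA -EFinM divff ?gt_eqF// mul1e.
by rewrite !E h.
Qed.

(* [esum] is a supremum over finite subsets, the empty one included. *)
Lemma esum_ge0_gen (T : choiceType) (S : set T) (a : T -> \bar R) :
  0 <= \esum_(x in S) a x.
Proof.
apply: ereal_sup_ubound.
by exists set0; [exact: fsets_set0|rewrite fsbig_set0].
Qed.

Section conditional_bound.
Variable phi : R -> R.
Variable G : set 'rV[R]_d -> 'rV[R]_d -> \bar R.
Variable Nn : set O.
Hypothesis i0 : 0 < intensity P pts.
Hypothesis ioo : intensity P pts < +oo.
Hypothesis mG : forall S : set (\bar R), measurable S -> N_sig_x [set p | S (G p.1 p.2)].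
Hypothesis EG : forall D, N_sig_x D ->
  E0 P pts theta (fun w => \esum_(x in pts w) (c 0%R x w * \1_D (pts w, x))%:E)
  = E0 P pts theta (fun w => \esum_(x in pts w) (G (pts w) x * (\1_D (pts w, x))%:E)).
Hypothesis mNn : measurable Nn.
Hypothesis ENn : E0 P pts theta (fun w => (\1_Nn w)%:E) = 0.
Hypothesis Gphi : forall w, ~ Nn w -> forall x, DTedge (pts w) 0%R x ->
  G (pts w) x <= (phi (enorm x))%:E.

(* Cutting [D n] down to [{G <= Phi n}] loses no edge outside [Nn], so that the
   Delaunay graph itself need not be shown measurable. *)
Lemma palm_lamk_le k (D : nat -> set (set 'rV[R]_d * 'rV[R]_d)) (W Phi : nat -> R) :
  (forall n, N_sig_x (D n)) -> (forall n, 0 <= W n)%R -> (forall n, 0 <= Phi n)%R ->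
  (forall w y, DTedge (pts w) 0%R y -> exists n, D n (pts w, y)) ->
  (forall n xi y, D n (xi, y) -> enorm y ^+ k <= W n /\ phi (enorm y) <= Phi n)%R ->
  palm (lamk pts c k) <= \sum_(n <oo) (W n * Phi n)%:E *
    palm (fun w => \esum_(y in pts w) (\1_(D n) (pts w, y) : R)%:E).
Proof.
move=> mD W0 Phi0 Dcover DW.
pose D' n := D n `&` [set p | G p.1 p.2 <= (Phi n)%:E].
have mD' n : N_sig_x (D' n).
  rewrite N_sig_xE; apply: measurableI; first exact (mD n).
  rewrite (_ : [set p | _] = [set p | [set` `]-oo, (Phi n)%:E]] (G p.1 p.2)]).
    exact (mG (emeasurable_itv `]-oo, (Phi n)%:E])).
  by apply/seteqP; split => p /=; rewrite in_itv.
pose h n w y := (c 0%R y w * \1_(D' n) (pts w, y))%R : R.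
have h0 n w y : (0 <= h n w y)%R by rewrite mulr_ge0.
have mh n : measurable_fun setT (fun p : V * O => (h n p.2 p.1)%:E).
  apply/measurable_EFinP; apply: measurable_funM; first exact: measurable_conductance.
  exact: measurable_config_indic.
pose f n w := \esum_(y in pts w) ((W n)%:E * (h n w y)%:E).
have fE n w : f n w = (W n)%:E * \esum_(y in pts w) (h n w y)%:E.
  by rewrite /f esumZl// => y; rewrite lee_fin.
have msum n : measurable_fun setT (fun w => \esum_(y in pts w) (h n w y)%:E).
  apply: (measurable_pts_sum lf mcnt (F := fun p : V * O => (h n p.2 p.1)%:E)) => // p.
  by rewrite lee_fin.
have sum0 n w : 0 <= \esum_(y in pts w) (h n w y)%:E.
  by apply: esum_ge0 => y _; rewrite lee_fin.
have f0 n w : 0 <= f n w by rewrite fE mule_ge0// lee_fin.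
have mf n : measurable_fun setT (f n).
  have -> : f n = (fun w => (W n)%:E * \esum_(y in pts w) (h n w y)%:E).
    by apply/funext => w; exact: fE.
  exact: measurable_funeM.
have lamk_f w : ~ Nn w -> lamk pts c k w <= \sum_(n <oo) f n w.
  move=> Nw; rewrite /f.
  rewrite -esum_nneseries; last by move=> n y; rewrite mule_ge0// lee_fin.
  apply: (@le_trans _ _ (\esum_(y in [set y | DTedge (pts w) 0%R y])
      \sum_(n <oo) (W n)%:E * (h n w y)%:E)); last first.
    by apply: esum_subset => y [].
  apply: le_esum => y yE; have [n Dn] := Dcover _ _ yE.
  have [yW yPhi] := DW _ _ _ Dn.
  rewrite nneseries_esumT; last by move=> m; rewrite mule_ge0// lee_fin.
  apply: (@le_trans _ _ ((W n)%:E * (h n w y)%:E)).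
    rewrite -EFinM lee_fin /h indicE mem_set ?mulr1; last first.
      by split => //=; apply: (le_trans (Gphi Nw yE)); rewrite lee_fin.
    by rewrite mulrC ler_wpM2r.
  apply: (@le_esum_term _ _ setT (fun m => (W m)%:E * (h m w y)%:E) n) => //.
  by move=> m _; rewrite mule_ge0// lee_fin.
(* The Palm-null set of the conditional bound becomes a [P]-null set M, off which every point of the
   unit cube sees a good configuration. *)
have /(palm_null mtheta lf mcnt mNn)[M [mM PM hM]] : palm (fun w => (\1_Nn w)%:E) = 0.
  have p0 : palm (cst 0) = 0.
    by rewrite /palm_sum; apply: integral0_eq => w _; exact: esum1.
  rewrite -p0; apply: (E0_palm_inj i0 ioo); rewrite ENn; apply/esym.
  by rewrite -[RHS](mule0 (fine (intensity P pts))^-1%:E) -[in RHS]p0.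
apply: (@le_trans _ _ (palm (fun w => \sum_(n <oo) f n w))).
  apply: (ae_le_integral_gen mM PM).
  - by move=> w; apply: esum_ge0_gen.
  - by move=> w; apply: esum_ge0_gen.
  - apply: (measurable_palm_sum mtheta lf mcnt (f := fun w => \sum_(n <oo) f n w)).
      by move=> w; exact: nneseries_ge0.
    by apply: ge0_emeasurable_sum => // n w _ _.
  - move=> w Mw; apply: le_esum => x [ptx cx]; apply: lamk_f; exact: hM ptx cx.
rewrite palm_nneseries//; apply: lee_nneseries => n.
  by move=> *; apply: integral_ge0 => w _; exact: esum_ge0_gen.
move=> _.
have -> : f n = (fun w => (W n)%:E * \esum_(y in pts w) (h n w y)%:E).
  by apply/funext => w; exact: fE.
rewrite palmZl// EFinM -muleA lee_wpmul2l ?lee_fin//.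
(* Testing on [D' n] trades the conductance for G, which is at most [Phi n] on that set. *)
rewrite (E0_palm_inj i0 ioo (EG (mD' n))).
have m1 : measurable_fun setT (fun w => \esum_(y in pts w) (\1_(D n) (pts w, y) : R)%:E).
  apply: (measurable_pts_sum lf mcnt (F := fun p : V * O => (\1_(D n) (pts p.2, p.1))%:E)).
    by move=> p; rewrite lee_fin.
  by apply/measurable_EFinP; exact: measurable_config_indic.
rewrite -palmZl//; last by move=> w; apply: esum_ge0 => y _; rewrite lee_fin.
apply: le_palm => w; first exact: esum_ge0_gen.
rewrite -esumZl//.
apply: le_esum => y _; rewrite !indicE.
have [/set_mem[Dy Gy]|_] := boolP (_ \in D' n).
  by rewrite mem_set//= !mule1.
by rewrite mule0 mule_ge0// lee_fin.
Qed.

Section finiteness.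
Variable Os : set O.
Hypothesis mOs : measurable Os.
Hypothesis POs : P Os = 1.
Hypothesis hOs : forall w, Os w -> forall x, pts (theta x w) = [set y - x | y in pts w]%R.
Hypothesis stat : forall u v r (S : set (\bar R)), measurable S ->
  P [set w | S (cnt (pts w) (box u r))] = P [set w | S (cnt (pts w) (box v r))].
Variables (C0 zeta beta : R) (k : nat).
Hypothesis d0 : (0 < d)%N.
Hypothesis phi_loc : forall r, (0 <= r)%R -> exists M : R, forall s, (0 <= s <= r -> phi s <= M)%R.
Hypothesis C00 : (0 < C0)%R.
Hypothesis zeta0 : (0 <= zeta)%R.
Hypothesis phi_tail : forall r, (1 <= r -> phi r <= C0 * r `^ (zeta - 2))%R.

Lemma palm_lamk_lty : (k <= 2)%N -> rho P pts 2 < +oo -> decoupled P pts beta ->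
  (d%:R + zeta < beta)%R -> palm (lamk pts c k) < +oo.
Proof.
move=> k2 r2 dec hbeta.
have [C [l0 [C0' l01 hole_le]]] := hole_moment_le lf mcnt d0 dec.
(* Large enough for the threshold of [hole_le] and for the lower bound 2 in
   [hole_of_sector_empty]. *)
pose b := (Num.truncn l0).+2.
have bl0 : (l0 <= b%:R)%R.
  have l0' : (0 <= l0)%R by lra.
  by have /andP[_ /ltW/le_trans] := truncn_itv l0'; apply; rewrite ler_nat.
have b2 : (2 <= b)%N by [].
pose D n := @annulus R d b n.
pose ra n : R := (@outer_radius d b n)%:R; pose l n : R := (dyadic_scale b n)%:R.
have l_ge n : (b%:R <= l n)%R by rewrite ler_nat leq_b_scale.
have b2R : (2 <= b%:R :> R)%R by rewrite ler_nat.
have ra1 n : (1 <= ra n)%R by rewrite ler1n outer_radius_gt0.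
have raS n : ra n.+1 = (2 * ra n)%R by rewrite /ra outer_radiusS natrM.
have raE n : ra n = (72 * d%:R * l n)%R by exact: outer_radiusE.
have [M0 hM0] := phi_loc (le_trans ler01 (ra1 0%N)).
pose M := Num.max M0 0%R.
pose W n := (ra n ^+ k)%R.
(* As zeta >= 0, the factor |y|^zeta is largest at the outer radius and |y|^(-2) at the inner one.
   The innermost ball relies on local boundedness. *)
pose Phi n : R := if n is n'.+1 then (C0 * ra n `^ zeta / ra n' ^+ 2)%R else M.
have Phi0 n : (0 <= Phi n)%R.
  case: n => [|n] /=; first by rewrite le_max lexx orbT.
  by rewrite divr_ge0 ?sqr_ge0// mulr_ge0 ?powR_ge0 ?ltW.
have ra0 n : (0 < ra n)%R by rewrite (lt_le_trans _ (ra1 n)).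
have W0 n : (0 <= W n)%R by rewrite exprn_ge0 ?ltW.
have DW n xi y : D n (xi, y) -> (enorm y ^+ k <= W n /\ phi (enorm y) <= Phi n)%R.
  have ey := enorm_ge0 y.
  case: n => [|n] /=.
    move=> yr; split; first by rewrite lerXn2r ?nnegrE ?(ltW (ra0 _)).
    by rewrite le_max hM0// ey.
  move=> [yl yr _]; split; first by rewrite lerXn2r ?nnegrE ?(ltW (ra0 _)).
  have y1 : (1 <= enorm y)%R by rewrite ltW// (le_lt_trans (ra1 n)).
  have y0 : (0 < enorm y)%R by lra.
  apply: (le_trans (phi_tail y1)).
  rewrite powRB; last by rewrite (gt_eqF y0) implybT.
  rewrite -mulrA ler_pM2l// (powR_mulrn 2 ey).
  apply: ler_pM; rewrite ?powR_ge0 ?invr_ge0 ?sqr_ge0//.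
    by rewrite ge0_ler_powR ?nnegrE ?(ltW (ra0 _)).
  rewrite lef_pV2 ?posrE ?exprn_gt0//; apply: lerXn2r; rewrite ?nnegrE ?(ltW (ra0 _))//.
  exact: ltW yl.
have mD n : N_sig_x (D n) by exact: N_sig_x_annulus.
have cover w y : DTedge (pts w) 0%R y -> exists n, D n (pts w, y) by exact: annulus_cover.
have le := palm_lamk_le mD W0 Phi0 cover DW.
apply: (le_lt_trans le).
set p := fun n => palm (fun w => \esum_(y in pts w) (\1_(D n) (pts w, y))%:E).
have p0 n : 0 <= p n by apply: integral_ge0 => w _; exact: esum_ge0_gen.
have LamD n xi y : D n (xi, y) -> Lam (@outer_radius d b n)%:R y.
  move=> Dn i; apply: (le_trans (coord_le_enorm y i)).
  by case: n Dn => [|n] //= [].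
(* No hole is available here, only the finite second moment. *)
have p_0 : p 0%N < +oo.
  apply: (@le_lt_trans _ _ _ _ _ _ (pair_moment_lty (N := (@outer_radius d b 0).+1) lf mcnt _ stat r2)) => //.
  have DU w x y : Os w -> cube01 x -> D 0%N (pts (theta x w), y) -> setT w by [].
  exact (palm_pair_le mOs POs hOs measurableT (LamD 0%N) DU).
have p_S n : p n.+1 <= (((2 * (@outer_radius d b n.+1).+1) ^ d)%:R * (C * l n `^ (- beta)))%:E.
  apply: le_trans (hole_le (l n) (@outer_radius d b n.+1).+1 _ _) => //; last first.
    by rewrite (le_trans bl0).
  apply: (palm_pair_le mOs POs hOs _ (LamD n.+1)).
    exact: measurable_hole.
  move=> w x y Ow cx [_ _]; rewrite /= hOs//; apply: hole_of_sector_empty => //.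
  exact: le_trans b2R (l_ge n).
pose q := (2 `^ (zeta + d%:R - beta))%R : R.
have q0 : (0 < q)%R by rewrite powR_gt0.
have q1 : (q < 1)%R.
  rewrite /q /powR gt_eqF// expR_lt1 pmulr_llt0 ?ln_gt0 ?ltr1n//; lra.
pose A := (4 * C0 * C * (144 * d%:R) `^ zeta * (576 * d%:R) ^+ d
  * b%:R `^ (zeta + d%:R - beta))%R.
have A0 : (0 <= A)%R.
  have X0 : (0 <= (576 * d%:R : R) ^+ d)%R.
    exact (exprn_ge0 _ (mulr_ge0 (ler0n R 576) (ler0n R d))).
  have Y0 : (0 <= 4 * C0 * C)%R by rewrite mulr_ge0// mulr_ge0 ?ler0n// ltW.
  by rewrite /A; apply: mulr_ge0 (powR_ge0 _ _); apply: mulr_ge0 X0; apply: mulr_ge0 (powR_ge0 _ _).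
(* Term n+1 is bounded by A q^n = (A / q) q^(n+1); the second summand takes care of term 0. *)
pose B := (A / q + W 0%N * Phi 0%N * fine (p 0%N))%R.
have f0 : (0 <= W 0%N * Phi 0%N * fine (p 0%N))%R by rewrite !mulr_ge0 ?fine_ge0.
have Aq : (0 <= A / q)%R by rewrite divr_ge0// ltW.
apply: (@nneseries_geometric_lty _ _ B q) => // [|n|[|n]].
- by rewrite addr_ge0.
- by apply: mule_ge0; [rewrite lee_fin mulr_ge0|exact: p0].
- rewrite -/(p 0%N); have -> : p 0%N = (fine (p 0%N))%:E by rewrite fineK// ge0_fin_numE.
  by rewrite -EFinM lee_fin expr0 mulr1 lerDr.
apply: (le_trans (lee_wpmul2l _ (p_S n))); first by rewrite lee_fin mulr_ge0.
rewrite -EFinM lee_fin.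
apply: (@le_trans _ _ (A / q * q ^+ n.+1)%R); last first.
  by rewrite ler_wpM2r ?exprn_ge0 ?(ltW q0)// lerDl.
have -> : (A / q * q ^+ n.+1 = A * q ^+ n)%R by rewrite exprS mulrA divfK ?gt_eqF.
have -> : (A * q ^+ n = 4 * C0 * C * (144 * d%:R) `^ zeta * (576 * d%:R) ^+ d
    * l n `^ (zeta + d%:R - beta))%R.
  have -> : l n = (b%:R * (2 ^ n)%N%:R)%R by rewrite -natrM.
  by rewrite (powRM _ (ler0n R b) (ler0n R (2 ^ n)%N)) powR_nat_exp mulrA.
have -> : (((2 * (@outer_radius d b n.+1).+1) ^ d)%:R = (2 * (2 * ra n + 1)) ^+ d :> R)%R.
  by rewrite natrX natrM -[(@outer_radius d b n.+1).+1%:R]natr1 -/(ra n.+1) raS.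
rewrite /W /Phi raS; apply: annulus_term_bound => //.
- exact: ltW.
- by apply: le_trans (l_ge n); lra.
Qed.

End finiteness.
End conditional_bound.
End conductances.
End Palm_bounds.

(** A nonnegative q satisfies q^2 <= 1 + q^gamma. *)
Lemma rho2_lty (R : realType) (d : nat) (dO : measure_display)
    (O : measurableType dO) (P : probability O R) (pts : O -> set 'rV[R]_d)
    (gamma : R) :
  (forall A, borelV A -> measurable_fun setT (fun w => cnt (pts w) A)) ->
  2 < gamma -> (rho P pts gamma < +oo)%E -> (rho P pts 2 < +oo)%E.
Proof.
move=> mcnt g2 gfin.
have mg : measurable_fun setT (fun y : R => y `^ gamma) by exact: measurable_powR.
apply: (@le_lt_trans _ _ (\int[P]_w (1%:E + (num_pts pts w cube01 `^ gamma)%:E))%E).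
  apply: ge0_le_integral_gen => w; first by rewrite lee_fin powR_ge0.
  rewrite -EFinD lee_fin -/(num_pts pts w cube01).
  have [q1|q1] := leP (num_pts pts w cube01) 1.
    rewrite (@le_trans _ _ 1)// ?lerDl ?powR_ge0//.
    by rewrite (powR_mulrn 2 (npts_ge0 _ _ _)) expr_le1 ?npts_ge0.
  by rewrite (@le_trans _ _ (num_pts pts w cube01 `^ gamma))// ?lerDr// ler_powR// ltW.
rewrite ge0_integralD//.
- rewrite lte_add_pinfty// integral_cst// mul1e.
  by rewrite (le_lt_trans (probability_le1 P measurableT))// ltry.
- by move=> w _; rewrite lee_fin powR_ge0.
- apply/measurable_EFinP.
  exact (measurableT_comp mg (measurable_npts mcnt (@borel_cube01 R d))).
Qed.

Unset Implicit Arguments.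
Set Strict Implicit.
Set Printing Implicit Defensive.

Theorem theorem4p9 (R : realType) (d : nat) (dO : measure_display)
  (O : measurableType dO) (P : probability O R)
  (theta : 'rV[R]_d -> O -> O) (pts : O -> set 'rV[R]_d)
  (c : 'rV[R]_d -> 'rV[R]_d -> O -> R)
  (phi : R -> R) (C0 zeta : R) :
  (0 < d)%N ->
  (* (theta_x) is a measurable action of R^d on O *)
  (forall w, theta 0 w = w) ->
  (forall x y w, theta (x + y) w = theta x (theta y w)) ->
  (forall U, measurable U -> prod_sig (O:=O) [set p | U (theta p.1 p.2)]) ->
  (* omega |-> hat omega is a (simple) point process *)
  (forall w, locfin (pts w)) ->
  (forall A, borelV A -> measurable_fun setT (fun w => cnt (pts w) A)) ->
  (* measurable symmetric conductance field supported on DT edges *)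
  (forall x y w, 0 <= c x y w) ->
  (forall x y w, c x y w = c y x w) ->
  (forall x w, c x x w = 0) ->
  (forall x y w, ~ DTedge (pts w) x y -> c x y w = 0) ->
  (forall S : set R, measurable S ->
     prod2_sig (O:=O) [set p | S (c p.1.1 p.1.2 p.2)]) ->
  (* (A1) *)
  (forall x U, measurable U -> P (theta x @^-1` U) = P U) ->
  P [set w | pts w = set0] = 0%E ->
  (* (A2) *)
  (0 < intensity P pts)%E -> (intensity P pts < +oo)%E ->
  (* (A3) *)
  (exists Ostar : set O,
     [/\ measurable Ostar,
         forall x w, Ostar (theta x w) <-> Ostar w,
         P Ostar = 1%E &
         forall w, Ostar w -> forall x,
           pts (theta x w) = [set y - x | y in pts w] /\
           forall y z, DTedge (pts w) y z ->
             c (y - x) (z - x) (theta x w) = c y z w]) ->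
  (* phi : R_+ -> R_+ locally bounded, measurable, phi(r) <= C0 r^(-2+zeta) *)
  measurable_fun [set r : R | 0 <= r] phi ->
  (forall r, 0 <= r -> 0 <= phi r) ->
  (forall r, 0 <= r -> exists M : R, forall s, 0 <= s <= r -> phi s <= M) ->
  0 < C0 -> 0 <= zeta ->
  (forall r, 1 <= r -> phi r <= C0 * r `^ (zeta - 2)) ->
  (* E_0[c_{0,x} | hat omega] <= phi(|x|) for x ~ 0, P_0-a.s.;
     G is (a version of) the conditional expectation E_0[c_{0,x} | hat omega] *)
  (exists G : set 'rV[R]_d -> 'rV[R]_d -> \bar R,
     [/\ forall S : set (\bar R), measurable S ->
           N_sig_x [set p | S (G p.1 p.2)],
         forall D, N_sig_x D ->
           E0 P pts theta
             (fun w => \esum_(x in pts w) (c 0 x w * \1_D (pts w, x))%:E)%E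
           = E0 P pts theta
             (fun w => \esum_(x in pts w) (G (pts w) x * (\1_D (pts w, x))%:E))%E &
         exists Nn : set O,
           [/\ measurable Nn,
               E0 P pts theta (fun w => (\1_Nn w)%:E) = 0%E &
               forall w, ~ Nn w -> forall x, DTedge (pts w) 0 x ->
                 (G (pts w) x <= (phi (enorm x))%:E)%E]]) ->
  (* (H1) or (H2) or (H3) *)
  ((exists gamma : R, [/\ 2 < gamma, (rho P pts gamma < +oo)%E &
      exists alpha : R,
        gamma / (gamma - 2) * (d%:R + zeta) < alpha /\ condC P pts alpha])
   \/ ((rho P pts 2 < +oo)%E /\ finite_range P pts)
   \/ [/\ (rho P pts 2 < +oo)%E, pos_assoc P pts &
          exists alpha : R, d%:R + zeta < alpha /\ condC P pts alpha]) ->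
  (* lambda_0, lambda_2 in L^1(P_0) *)
  forall k : nat, k = 0%N \/ k = 2%N ->
    measurable_fun setT (lamk pts c k) /\
    (E0 P pts theta (lamk pts c k) < +oo)%E.
Proof.
move=> d0 _ _ mtheta lf mcnt c0 _ _ csupp mc Pinv nonempty i0 ioo [Os [mOs _ POs hA3]].
move=> _ _ phi_loc C00 zeta0 phi_tail [G [mG EG [Nn [mNn ENn Gphi]]]] hyp k hk.
have hOs w : Os w -> forall x, pts (theta x w) = [set y - x | y in pts w].
  by move=> Ow x; exact: (hA3 w Ow x).1.
have stat u v r (S : set (\bar R)) : measurable S ->
  P [set w | S (cnt (pts w) (box u r))] = P [set w | S (cnt (pts w) (box v r))].
  exact: (prob_cnt_box_center mtheta mcnt Pinv mOs POs hOs).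
split; first exact: (measurable_lamk lf mcnt c0 csupp mc hk).
(* The three alternatives enter the rest of the argument only through a decoupling exponent above d
   + zeta and a finite second moment. *)
have [beta [r2 hbeta dec]] : exists beta : R,
    [/\ (rho P pts 2 < +oo)%E, d%:R + zeta < beta & decoupled P pts beta].
  have dz : 0 < d%:R + zeta by rewrite ltr_pwDl// ltr0n.
  case: hyp => [[gamma [g2 gfin [alpha [ha hC]]]]|[[r2 [L [L0 indep]]]|[r2 pa [alpha [ha hC]]]]].
  - have gp : 0 < (gamma - 2) / gamma by rewrite divr_gt0//; lra.
    have a0 : 0 < alpha.
      by apply: lt_trans ha; rewrite mulr_gt0// divr_gt0//; lra.
    (* The lower bound on alpha in (H1) says exactly that this exponent exceeds d + zeta. *)
    exists (alpha * ((gamma - 2) / gamma)); split.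
    + exact: rho2_lty gfin.
    + by rewrite -ltr_pdivrMr// invf_div mulrC.
    + exact: moment_decoupled.
  (* Finite range yields every positive exponent, so any value above d + zeta will do. *)
  - exists (d%:R + zeta + 1); split => //; first by rewrite ltrDl.
    by apply: (range_decoupled mcnt stat d0 indep L0 nonempty) => //; lra.
  - by exists alpha; split => //; exact: assoc_decoupled.
rewrite /E0 lte_mul_pinfty ?lee_fin ?invr_ge0 ?fine_ge0 ?(ltW i0)//.
apply: (palm_lamk_lty mtheta lf mcnt c0 mc i0 ioo mG EG mNn ENn Gphi mOs POs hOs stat
  d0 phi_loc C00 zeta0 phi_tail _ r2 dec hbeta).
by case: hk => ->.
Qed.
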